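(* For any involution-free graph $H$, there is a polynomial-time Turing reduction from $\oplus\textsc{PartLabHomsTo}H$ to $\oplus\textsc{HomsTo}H$.
   Context: Graphs are finite, simple, undirected, loopless. An involution of $H$ is an automorphism $\rho\neq\mathrm{id}$ with $\rho^2=\mathrm{id}$; $H$ is involution-free if it has none. A partially $H$-labelled graph $J=(G,\tau)$ consists of a graph $G$ and a partial function $\tau$ from $V(G)$ to $V(H)$. A homomorphism from $J$ to $H$ is a graph homomorphism $\sigma:G\to H$ (a map sending edges to edges) with $\sigma(v)=\tau(v)$ for all $v\in\mathrm{dom}(\tau)$; $\mathrm{Hom}(J,H)$ denotes the set of these. $\oplus\textsc{PartLabHomsTo}H$ is the problem: given a partially $H$-labelled graph $J$, compute $|\mathrm{Hom}(J,H)|\bmod 2$. $\oplus\textsc{HomsTo}H$ is the problem: given a graph $G$, compute $|\mathrm{Hom}(G,H)|\bmod 2$. *)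

(* Defs.v *)
From mathcomp Require Import all_boot all_fingroup all_algebra.

Set Implicit Arguments.
Unset Strict Implicit.
Unset Printing Implicit Defensive.

Record sgraph := SGraph {
  vertex :> finType;
  adj : rel vertex;
  adj_sym : symmetric adj;
  adj_irr : irreflexive adj }.

Definition automorphism (H : sgraph) (rho : {perm H}) : Prop :=
  forall x y : H, adj (rho x) (rho y) = adj x y.

Definition involution (H : sgraph) (rho : {perm H}) : Prop :=
  [/\ automorphism rho, rho <> 1%g & (rho ^+ 2 = 1)%g].

Definition involution_free (H : sgraph) : Prop :=
  ~ exists rho : {perm H}, involution rho.

(* The value [None] of [lab] means that the vertex is unlabelled. *)
Record partlab (H : sgraph) := PartLab {
  underlying : sgraph;
  lab : underlying -> option H }.

Definition is_hom (G H : sgraph) (s : {ffun G -> H}) : bool :=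
  [forall x, forall y, adj x y ==> adj (s x) (s y)].

Definition Hom (G H : sgraph) : {set {ffun G -> H}} :=
  [set s | is_hom s].

Definition respects (H : sgraph) (J : partlab H)
    (s : {ffun underlying J -> H}) : bool :=
  [forall x, if lab x is Some h then s x == h else true].

Definition LabHom (H : sgraph) (J : partlab H) :
    {set {ffun underlying J -> H}} :=
  [set s | is_hom s & respects s].

(* A graph is presented with its vertices in the order of [enum]: the number
   of vertices in unary, a separator, then the adjacency matrix row by row.
   As a graph may have any finite vertex type, every presentation of every
   graph on {0, ..., n-1} arises in this way. *)
Definition encode_graph (G : sgraph) : seq bool :=
  nseq #|G| true ++ false :: [seq adj x y | x <- enum G, y <- enum G].

Definition encode_label (H : sgraph) (l : option H) : seq bool :=
  if l is Some h then nseq (enum_rank h).+1 true ++ [:: false]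
  else [:: false].

Definition encode_partlab (H : sgraph) (J : partlab H) : seq bool :=
  encode_graph (underlying J) ++
  flatten [seq encode_label (lab x) | x <- enum (underlying J)].

(* The value to be computed is a residue modulo 2, given as a bit. *)
Record parity_problem := ParityProblem {
  instance : Type;
  encode : instance -> seq bool;
  answer : instance -> bool }.

Definition ParityHomsTo (H : sgraph) : parity_problem :=
  {| instance := sgraph;
     encode := encode_graph;
     answer := fun G => odd #|Hom G H| |}.

Definition ParityPartLabHomsTo (H : sgraph) : parity_problem :=
  {| instance := partlab H;
     encode := @encode_partlab H;
     answer := fun J => odd #|LabHom J| |}.

(* Oracle Turing machines with finitely many two-way infinite tapes over the
   alphabet {0, 1, blank}, where [None] is the blank.  A tape is given by the
   cells from the head rightwards and the cells left of the head, nearest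
   first; the cells beyond both lists are blank. *)
Definition symbol := option bool.

Record tape := Tape { lefts : seq symbol; rights : seq symbol }.

Inductive move := MoveLeft | Stay | MoveRight.

Definition read (t : tape) : symbol := head None (rights t).

Definition write_move (a : symbol) (m : move) (t : tape) : tape :=
  match m with
  | MoveLeft =>
      Tape (behead (lefts t)) (head None (lefts t) :: a :: behead (rights t))
  | Stay => Tape (lefts t) (a :: behead (rights t))
  | MoveRight => Tape (a :: lefts t) (behead (rights t))
  end.

Definition tape_of_word (w : seq bool) : tape := Tape [::] (map Some w).

(* The word from the head rightwards up to the first blank. *)
Fixpoint leading_word (s : seq symbol) : seq bool :=
  if s is Some b :: s' then b :: leading_word s' else [::].

Definition word_of_tape (t : tape) : seq bool := leading_word (rights t).

(* What a machine does in a given state: stop with an output bit; ask the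
   oracle about the word on the query tape and continue in the first or the
   second state according to the answer 1 or 0; or make an ordinary step
   determined by the symbols under the heads. *)
Inductive command (tapes state : finType) :=
  | Halt of bool
  | Query of state & state
  | Step of ({ffun tapes -> symbol} -> state * (tapes -> symbol * move)).

Arguments Halt {tapes state} _.
Arguments Query {tapes state} _ _.

Record oracle_machine := OracleMachine {
  tapes : finType;
  state : finType;
  input_tape : tapes;
  query_tape : tapes;
  start : state;
  program : state -> command tapes state }.

Section Run.

Variables (M : oracle_machine) (O : seq bool -> bool).

Definition config : Type := state M * {ffun tapes M -> tape}.

Definition init (w : seq bool) : config :=
  (start M,
   [ffun i => if i == input_tape M then tape_of_word w else Tape [::] [::]]).

Definition step (c : config) : config :=
  match program c.1 with
  | Halt _ => c
  | Query yes no =>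
      (if O (word_of_tape (c.2 (query_tape M))) then yes else no, c.2)
  | Step delta =>
      let: (q, act) := delta [ffun i => read (c.2 i)] in
      (q, [ffun i => write_move (act i).1 (act i).2 (c.2 i)])
  end.

Definition output (c : config) : option bool :=
  if program c.1 is Halt b then Some b else None.

Definition computes_within (w : seq bool) (t : nat) (b : bool) : Prop :=
  output (iter t step (init w)) = Some b.

End Run.

(* Every oracle query, whatever its length, costs one step.  The oracle
   answers correctly on all encodings of instances of [Q] and arbitrarily on
   all other words. *)
Definition solves (Q : parity_problem) (O : seq bool -> bool) : Prop :=
  forall y : instance Q, O (encode y) = answer y.

Definition poly_turing_reducible (P Q : parity_problem) : Prop :=
  exists (M : oracle_machine) (p : {poly nat}),
  forall O : seq bool -> bool, solves Q O ->
  forall x : instance P,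
    computes_within M O (encode x) (p.[size (encode x)])%R (answer x).

(* Two graphs with the same encoding are isomorphic, so that [ParityHomsTo H]
   is well defined on encodings and the oracles in [poly_turing_reducible]
   exist. *)
Lemma encode_graph_iso (G G' : sgraph) : encode_graph G = encode_graph G' ->
  exists2 f : G -> G', bijective f & forall x y, adj (f x) (f y) = adj x y.
Proof.
rewrite /encode_graph => eqe.
have size_unary (n : nat) (s : seq bool) :
    find negb (nseq n true ++ false :: s) = n.
  by rewrite find_cat has_nseq andbF size_nseq /= addn0.
have eqn : #|G| = #|G'|.
  by have := congr1 (find negb) eqe; rewrite !size_unary.
have eqm : [seq adj x y | x <- enum G, y <- enum G] =
           [seq adj x y | x <- enum G', y <- enum G'].
  have := congr1 (drop #|G|.+1) eqe.
  have drop_unary (n : nat) (s : seq bool) :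
      drop n.+1 (nseq n true ++ false :: s) = s.
    by elim: n => //=; rewrite drop0.
  by rewrite drop_unary {1}eqn drop_unary.
have entry (K : sgraph) (x y : K) :
    nth false [seq adj x y | x <- enum K, y <- enum K]
      (enum_rank x * #|K| + enum_rank y) = adj x y.
  have szE : size (enum K) = #|K| by rewrite -cardE.
  have gen (s : seq K) : x \in s ->
      nth false [seq adj u v | u <- s, v <- enum K]
        (index x s * #|K| + index y (enum K)) = adj x y.
    have ly : index y (enum K) < #|K| by rewrite -szE index_mem mem_enum.
    elim: s => //= u s IHs; rewrite in_cons nth_cat size_map szE.
    case: (eqVneq u x) => [-> _ | neux].
      rewrite mul0n add0n ly (nth_map x) ?szE // nth_index ?mem_enum //.
    move=> /= /IHs <-.
    by rewrite mulSn -addnA ltnNge leq_addr /= addKn.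
  have rk (z : K) : enum_rank z = index z (enum K) :> nat.
    rewrite -{2}[z]enum_rankK (enum_val_nth z) index_uniq ?enum_uniq //.
    by rewrite szE.
  by rewrite !rk gen ?mem_enum.
pose f (x : G) : G' := enum_val (cast_ord eqn (enum_rank x)).
pose g (x : G') : G := enum_val (cast_ord (esym eqn) (enum_rank x)).
exists f; first by exists g => x; rewrite /f /g enum_valK ?cast_ordK ?cast_ordKV
                                         enum_rankK.
move=> x y; rewrite -!entry /f !enum_valK -eqm /=.
by congr (nth _ _ (_ * _ + _)); rewrite eqn.
Qed.

Lemma encode_graph_homs (G G' H : sgraph) :
  encode_graph G = encode_graph G' -> #|Hom G H| = #|Hom G' H|.
Proof.
move=> /encode_graph_iso [f [g fK gK] fadj].
pose F (s : {ffun G -> H}) : {ffun G' -> H} := [ffun y => s (g y)].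
have injF : injective F.
  by move=> s t /ffunP eqF; apply/ffunP => x; move: (eqF (f x)); rewrite !ffunE fK.
rewrite -(card_imset _ injF); apply: eq_card => t; rewrite inE.
apply/imsetP/forallP => [[s] | homt].
  rewrite inE => /forallP homs -> x; apply/forallP => y; rewrite !ffunE.
  by move: (homs (g x)) => /forallP/(_ (g y)); rewrite -(fadj (g x)) !gK.
exists [ffun x => t (f x)]; last by apply/ffunP => y; rewrite !ffunE gK.
rewrite inE; apply/forallP => x; apply/forallP => y; rewrite !ffunE -fadj.
by move: (homt (f x)) => /forallP/(_ (f y)).
Qed.

(* Main.v *)
From mathcomp Require Import all_boot all_fingroup all_algebra zify.
Require Import Defs.

Set Implicit Arguments.
Unset Strict Implicit.
Unset Printing Implicit Defensive.

(** A map f : V(H) -> V(H) is injective iff the number of permutations p of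
    V(H) with f \o p = f is odd: if f identifies two vertices, composing with
    their transposition pairs these permutations off.  Add a copy of H to G,
    replace every labelled vertex by its label in that copy, and let G_p be
    the quotient identifying the vertices of the copy in the same orbit of p
    (only those p whose orbits contain no edge matter: H has no loops).
    Then the sum over p of |Hom(G_p, H)| has the parity of the number of
    homomorphisms that restrict to an automorphism of the copy of H.  Each
    automorphism extends in |Hom(J, H)| ways, and the number of automorphisms
    is odd because H has no involution.  Since H is fixed, this is a bounded
    number of oracle queries, whose matrices are definable from that of G by
    loops over the vertices.  (If adjacent vertices of G have nonadjacent
    labels, then Hom(J, H) is empty; otherwise the edges between labelled
    vertices may be dropped.) *)

(** * Pinning by summing over permutations *)

(** The elements moved by [i] come in pairs [x], [i x]; the induction removes one such pair at a
    time until all remaining elements are fixed. *)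
Lemma odd_card_involution (T : finType) (A : {set T}) (i : T -> T) :
  {in A, forall x, i x \in A} -> {in A, forall x, i (i x) = x} ->
  odd #|A| = odd #|[set x in A | i x == x]|.
Proof.
have [m] := ubnP #|A|; elim: m A => // m IHm A ltAm iA iK.
have [x Ax | fixA] := pickP [pred x in A | i x != x]; last first.
  congr (odd #|pred_of_set _|); apply/setP=> x; rewrite inE.
  by have := fixA x; rewrite /=; case: (x \in A) => //= /negbFE ->.
case/andP: Ax => Ax nix.
have Aix := iA x Ax.
pose B := A :\ x :\ i x.
have cA : #|A| = #|B|.+2.
  by rewrite (cardsD1 x) Ax (cardsD1 (i x)) !inE nix Aix.
have iB : {in B, forall y, i y \in B}.
  move=> y; rewrite !inE => /and3P[nyix nyx Ay]; rewrite iA // andbT.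
  apply/andP; split; apply: contraNneq nyx; last first.
    by move=> eqy; move: nyix; rewrite -eqy iK ?eqxx.
  by move/(congr1 i); rewrite !iK // => ->.
rewrite cA /= negbK IHm.
- congr (odd #|pred_of_set _|); apply/setP=> y; rewrite !inE.
  case: (eqVneq y x) => [-> | nyx] /=; first by rewrite (negbTE nix) andbF andbF.
  case: (eqVneq y (i x)) => [-> | //] /=.
  by rewrite iK // eq_sym (negbTE nix) andbF.
- by rewrite cA ltnS in ltAm; apply: ltnW.
- exact: iB.
by move=> y; rewrite !inE => /and3P[_ _ /iK].
Qed.

Lemma odd_sum_congr (I : finType) (P : pred I) (F G : I -> nat) :
  (forall i, P i -> odd (F i) = odd (G i)) ->
  odd (\sum_(i | P i) F i) = odd (\sum_(i | P i) G i).
Proof.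
move=> eqFG; apply: (big_ind2 (fun a b => odd a = odd b)) => //.
by move=> a a' b b' ea eb; rewrite !oddD ea eb.
Qed.

Section PermutationsFixingAMap.

Variables (T T' : finType) (f : {ffun T -> T'}).

Definition fixers := [set p : {perm T} | [forall x, f (p x) == f x]].

Lemma odd_card_fixers : odd #|fixers| = injectiveb f.
Proof.
apply/idP/injectiveP => [oddS x y fxy | injf].
  apply: contraTeq oddS => nxy.
  (* Products of permutations apply the left factor first, so the transposition acts before [p]. A
     fixed point of this involution would satisfy [p x = p y]. *)
  rewrite (odd_card_involution (i := fun p => (tperm x y * p)%g)).
  - rewrite (_ : [set p in _ | _] = set0) ?cards0 //.
    apply/setP=> p; rewrite !inE; apply/negbTE/negP => /andP[_ /eqP/permP/(_ x)].
    by rewrite permM tpermL => /perm_inj/esym/eqP; apply/negP.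
  - move=> p; rewrite !inE => /forallP fp; apply/forallP=> z; rewrite permM.
    rewrite (eqP (fp _)); case: tpermP => // ->; apply/eqP => //.
  - by move=> p _; rewrite mulgA tperm2 mul1g.
rewrite (_ : fixers = [set 1%g]) ?cards1 //; apply/setP=> p; rewrite !inE.
apply/forallP/eqP => [fp | -> x]; last by rewrite perm1.
by apply/permP=> x; rewrite perm1; apply/injf/eqP/fp.
Qed.

End PermutationsFixingAMap.

Section Pinning.

Variable H : sgraph.

Definition endo (f : {ffun H -> H}) : bool :=
  [forall x, forall y, adj x y ==> adj (f x) (f y)].

Lemma endoP (f : {ffun H -> H}) :
  reflect (forall x y, adj x y -> adj (f x) (f y)) (endo f).
Proof.
apply: (iffP forallP) => [h x y | h x]; first by move/forallP: (h x) => /(_ y)/implyP.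
by apply/forallP=> y; apply/implyP/h.
Qed.

(* Counting the edges shows that the inverse also preserves adjacency. *)
Lemma endo_inj_adj (f : {ffun H -> H}) : endo f -> injective f ->
  forall x y, adj (f x) (f y) = adj x y.
Proof.
move=> /endoP endof injf x y; apply/idP/idP; last exact: endof.
pose E := [set e : H * H | adj e.1 e.2].
pose F (e : H * H) := (f e.1, f e.2).
have injF : injective F by move=> [a b] [c d] [/injf-> /injf->].
have sFE : F @: E \subset E.
  by apply/subsetP=> _ /imsetP[e + ->]; rewrite !inE; apply: endof.
have /eqP eFE : F @: E == E by rewrite eqEcard sFE card_imset /=.
move=> afxy; have : F (x, y) \in E by rewrite inE.
by rewrite -eFE => /imsetP[e + /injF eqe]; rewrite -eqe inE.
Qed.

(** Inversion is an involution on the automorphisms. Its fixed points are those with trivial square,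
    and without involutions of [H] only the identity is left. *)
Lemma odd_card_automorphisms : involution_free H ->
  odd #|[set f : {ffun H -> H} | endo f && injectiveb f]|.
Proof.
move=> invfree.
pose A := [set p : {perm H} | endo [ffun x => p x]].
have endoA p : p \in A -> forall x y, adj (p x) (p y) = adj x y.
  rewrite inE => endop x y.
  have := @endo_inj_adj _ endop _ x y; rewrite !ffunE; apply.
  by move=> a b; rewrite !ffunE => /perm_inj.
have -> : [set f : {ffun H -> H} | endo f && injectiveb f] =
          [set [ffun x => p x] | p : {perm H} in A].
  apply/setP=> f; rewrite inE; apply/andP/imsetP => [[ef /injectiveP injf] | [p]].
    exists (perm injf); last by apply/ffunP=> x; rewrite ffunE permE.
    by rewrite inE (_ : [ffun x => _] = f) //; apply/ffunP=> x; rewrite ffunE permE.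
  rewrite inE => ep ->; split=> //; apply/injectiveP=> a b.
  by rewrite !ffunE => /perm_inj.
rewrite card_imset => [|p q /ffunP eqpq]; last first.
  by apply/permP=> x; have := eqpq x; rewrite !ffunE.
rewrite (odd_card_involution (i := fun p => p^-1)%g).
- rewrite (_ : [set p in _ | _] = [set 1%g]) ?cards1 //; apply/setP=> p.
  rewrite !inE; apply/andP/eqP => [[ep /eqP invp] | ->]; last first.
    by rewrite invg1; split=> //; apply/endoP=> x y; rewrite !ffunE !perm1.
  apply/eqP/idPn => /eqP np; case: invfree; exists p; split=> //.
    by apply: endoA; rewrite inE.
  by rewrite expgS expg1 -{1}invp mulVg.
- move=> p pA; rewrite inE; apply/endoP=> x y; rewrite !ffunE.
  by rewrite -(endoA p pA (p^-1 x)%g) !permKV.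
by move=> p _; rewrite invgK.
Qed.

(** * The quotient graphs *)

Section Gadget.

Variable p : {perm H}.

Definition orbit_type : finType := {A : {set H} | A \in porbits p}.

Lemma porbit_in_porbits (h : H) : porbit p h \in porbits p.
Proof. exact: imset_f. Qed.

Definition orbit_of (h : H) : orbit_type := Sub (porbit p h) (porbit_in_porbits h).

Lemma orbit_ofP (A : orbit_type) : exists h, A = orbit_of h.
Proof.
by case: A => A pA; have /imsetP[h _ eA] := pA; exists h; apply/val_inj.
Qed.

(** The condition [A != B] makes the quotient loopless for every [p], even if an orbit contains an
    edge; such [p] are discarded by [unmixed]. *)
Definition orbit_adj (A B : orbit_type) : bool :=
  (A != B) && [exists a, exists b, [&& orbit_of a == A, orbit_of b == B & adj a b]].

Definition unmixed : bool :=
  [forall a, forall b, (orbit_of a == orbit_of b) ==> ~~ adj a b].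

Lemma fixed_orbit (f : {ffun H -> H}) : p \in fixers f ->
  forall a b, orbit_of a = orbit_of b -> f a = f b.
Proof.
rewrite inE => /forallP fp a b /(congr1 val)/= eqab.
have : b \in porbit p a by rewrite eqab porbit_id.
case/porbitP => i ->; elim: i => [|i IHi]; first by rewrite perm1.
by rewrite expgSr permM (eqP (fp _)).
Qed.

Variable J : partlab H.
Local Notation G := (underlying J).

Definition unlabelled : finType := {x : G | lab x == None}.

Definition orbit_nbr (A : orbit_type) (x : G) : bool :=
  [exists v : G, if lab v is Some h then (orbit_of h == A) && adj v x else false].

(** Edges between two labelled vertices leave no trace here; they are accounted for by
    [labels_consistent]. *)
Definition pinned_adj (x y : orbit_type + unlabelled) : bool :=
  match x, y with
  | inl A, inl B => orbit_adj A B
  | inl A, inr u => orbit_nbr A (val u)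
  | inr u, inl A => orbit_nbr A (val u)
  | inr u, inr v => adj (val u) (val v)
  end.

Lemma pinned_adj_sym : symmetric pinned_adj.
Proof.
case=> [A|u] [B|v]; [| reflexivity | reflexivity | exact: adj_sym].
rewrite /pinned_adj /orbit_adj [B == A]eq_sym; apply: (congr1 (andb (A != B))).
by apply/existsP/existsP => -[a /existsP[b /and3P[ea eb ab]]];
  exists b; apply/existsP; exists a; rewrite ea eb /= adj_sym.
Qed.

Lemma pinned_adj_irr : irreflexive pinned_adj.
Proof. by case=> [A|u] /=; [rewrite /orbit_adj eqxx | exact: adj_irr]. Qed.

Definition pinned_graph : sgraph := SGraph pinned_adj_sym pinned_adj_irr.

End Gadget.

Variable J : partlab H.
Local Notation G := (underlying J).
Local Notation U := (unlabelled J).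

(** Replace each labelled vertex by its label in a copy of [H]. Together with [endo f], this says
    that [f] on the copy and [s] on the unlabelled vertices form a homomorphism to [H]. *)
Definition extends (f : {ffun H -> H}) (s : {ffun U -> H}) : bool :=
  [forall u, forall u', adj (val u) (val u') ==> adj (s u) (s u')] &&
  [forall u, forall v : G,
     if lab v is Some h then adj v (val u) ==> adj (f h) (s u) else true].

Lemma extendsP (f : {ffun H -> H}) (s : {ffun U -> H}) :
  reflect ((forall u u', adj (val u) (val u') -> adj (s u) (s u')) /\
           (forall u v h, lab v = Some h -> adj v (val u) -> adj (f h) (s u)))
          (extends f s).
Proof.
apply: (iffP andP) => [[ss fs] | [ss fs]]; split.
- by move=> u u'; move/forallP: ss => /(_ u)/forallP/(_ u')/implyP.
- move=> u v h lv; move/forallP: fs => /(_ u)/forallP/(_ v); rewrite lv.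
  by move/implyP.
- by apply/forallP=> u; apply/forallP=> u'; apply/implyP/ss.
apply/forallP=> u; apply/forallP=> v; case lv: (lab v) => [h|] //.
by apply/implyP/fs.
Qed.

Definition extensions (f : {ffun H -> H}) := [set s | extends f s].

(** Composition with the automorphism [f] is a bijection from the extensions of the identity to
    those of [f]. *)
Lemma card_extensions_automorphism (f : {ffun H -> H}) :
  endo f -> injective f -> #|extensions f| = #|extensions [ffun h => h]|.
Proof.
move=> endof injf.
have adjf := endo_inj_adj endof injf.
pose F (s : {ffun U -> H}) : {ffun U -> H} := [ffun u => f (s u)].
have injF : injective F.
  by move=> s t /ffunP eqst; apply/ffunP=> u; have := eqst u; rewrite !ffunE => /injf.
have [g fK gK] := injF_bij injf.
rewrite -[RHS](card_imset _ injF); apply: eq_card => t; rewrite inE.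
apply/extendsP/imsetP => [[tt ft] | [s + ->]].
  exists [ffun u => g (t u)]; last by apply/ffunP=> u; rewrite !ffunE gK.
  rewrite inE; apply/extendsP; split=> [u u' | u v h lv] auv; rewrite !ffunE.
    by rewrite -adjf !gK; apply: tt.
  by rewrite -adjf gK; apply: ft lv auv.
rewrite inE => /extendsP[ss fs]; split=> [u u' | u v h lv] auv; rewrite !ffunE.
  by rewrite adjf; apply: ss.
by have := fs u v h lv auv; rewrite ffunE adjf.
Qed.

Definition labels_consistent : bool :=
  [forall x : G, forall y : G,
     match lab x, lab y with
     | Some h, Some k => adj x y ==> adj h k
     | _, _ => true
     end].

Lemma labels_consistentP :
  reflect (forall (x y : G) h k, lab x = Some h -> lab y = Some k ->
             adj x y -> adj h k) labels_consistent.
Proof.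
apply: (iffP forallP) => [c x y h k lx ly | c x].
  by move/forallP: (c x) => /(_ y); rewrite lx ly => /implyP.
apply/forallP=> y; case lx: (lab x) => [h|] //; case ly: (lab y) => [k|] //.
by apply/implyP/(c x y).
Qed.

Lemma is_homP (K L : sgraph) (s : {ffun K -> L}) :
  reflect (forall x y, adj x y -> adj (s x) (s y)) (is_hom s).
Proof.
apply: (iffP forallP) => [h x y | h x]; first by move/forallP: (h x) => /(_ y)/implyP.
by apply/forallP=> y; apply/implyP/h.
Qed.

Lemma respectsP (s : {ffun underlying J -> H}) :
  reflect (forall x h, lab x = Some h -> s x = h) (respects s).
Proof.
apply: (iffP forallP) => [r x h lx | r x]; first by have := r x; rewrite lx => /eqP.
by case lx: (lab x) => [h|] //; apply/eqP/r.
Qed.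

(** A homomorphism respecting the labels is determined by its restriction to the unlabelled
    vertices, and the restrictions are the extensions of the identity, provided that the labels send
    edges to edges. *)
Lemma card_LabHom :
  #|LabHom J| = if labels_consistent then #|extensions [ffun h => h]| else 0.
Proof.
case: labels_consistentP => [cons | ncons]; last first.
  apply: eq_card0 => s; rewrite inE; apply/negP => /andP[/is_homP homs /respectsP rs].
  by case: ncons => x y h k lx ly /homs; rewrite (rs x h) ?(rs y k).
pose F (s : {ffun G -> H}) : {ffun U -> H} := [ffun u => s (val u)].
have injF : {in LabHom J &, injective F}.
  move=> s t; rewrite !inE => /andP[_ /respectsP rs] /andP[_ /respectsP rt] /ffunP eqst.
  apply/ffunP=> x; case lx: (lab x) => [h|]; first by rewrite (rs x h) ?(rt x h).
  have lx' : lab x == None by rewrite lx.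
  by have := eqst (Sub x lx'); rewrite !ffunE.
rewrite -(card_in_imset injF); apply: eq_card => t; rewrite [RHS]inE.
apply/imsetP/extendsP => [[s + ->] | [tt ft]].
  rewrite inE => /andP[/is_homP homs /respectsP rs].
  split=> [u u' | u v h lv] auv; rewrite !ffunE; first exact: homs.
  by rewrite -(rs v h lv); apply: homs.
have value (x : G) : exists h, if lab x is Some k then h = k
                              else exists2 u : U, val u = x & h = t u.
  case lx: (lab x) => [k|]; first by exists k.
  have lx' : lab x == None by rewrite lx.
  by exists (t (Sub x lx')), (Sub x lx').
have [s sP] := fin_all_exists value.
have sl x h : lab x = Some h -> s x = h by move=> lx; have := sP x; rewrite lx.
have su (u : U) : s (val u) = t u.
  by have := sP (val u); rewrite (eqP (valP u)) => -[u' /val_inj->].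
exists [ffun x => s x]; last by apply/ffunP=> u; rewrite !ffunE su.
rewrite inE; apply/andP; split; last by apply/respectsP=> x h lx; rewrite ffunE (sl x h).
apply/is_homP=> x y axy; rewrite !ffunE.
have cases (z : G) : (exists h, lab z = Some h) \/ exists u : U, val u = z.
  case lz: (lab z) => [k|]; [by left; exists k | right].
  have lz' : lab z == None by rewrite lz.
  by exists (Sub z lz').
case: (cases x) (cases y) axy => [[h lx]|[u <-]] [[k ly]|[v <-]] axy.
- by rewrite (sl x h) // (sl y k) //; apply: cons lx ly axy.
- by rewrite (sl x h) // su; have := ft v x h lx axy; rewrite ffunE.
- by rewrite (sl y k) // su adj_sym; have := ft u y k ly; rewrite ffunE; apply; rewrite adj_sym.
by rewrite !su; apply: tt.
Qed.

(** Homomorphisms are sorted by the map [f] that they induce on [H] through the quotient: it is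
    constant on orbits, and it is an endomorphism because [unmixed] lets every edge of [H] survive
    in the quotient. For a given [f], the values on the unlabelled vertices are exactly its
    extensions. *)
Lemma card_Hom_pinned (p : {perm H}) : unmixed p ->
  #|Hom (pinned_graph p J) H| =
  \sum_(f : {ffun H -> H} | endo f && (p \in fixers f)) #|extensions f|.
Proof.
move=> /forallP unm.
have unmix a b : adj a b -> orbit_of p a != orbit_of p b.
  move=> aab; apply/negP => eab.
  by have /forallP/(_ b)/implyP/(_ eab) := unm a; rewrite aab.
pose F (s : {ffun pinned_graph p J -> H}) : {ffun H -> H} :=
  [ffun h => s (inl (orbit_of p h))].
rewrite -sum1_card (partition_big F (fun f => endo f && (p \in fixers f))) /=; last first.
  move=> s; rewrite inE => /is_homP homs; apply/andP; split.
    apply/endoP=> a b aab; rewrite !ffunE; apply: homs; rewrite /= /orbit_adj unmix //=.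
    by apply/existsP; exists a; apply/existsP; exists b; rewrite !eqxx.
  rewrite inE; apply/forallP=> a; rewrite !ffunE; apply/eqP; congr (s (inl _)).
  by apply/val_inj=> /=; have := porbit_perm p 1 a; rewrite expg1.
apply: eq_bigr => f /andP[/endoP endof fixf]; rewrite sum1_card.
pose R (s : {ffun pinned_graph p J -> H}) : {ffun U -> H} := [ffun u => s (inr u)].
have injR : {in [pred s in Hom (pinned_graph p J) H | F s == f] &, injective R}.
  move=> s t; rewrite !inE => /andP[_ /eqP Fs] /andP[_ /eqP Ft] /ffunP eqst.
  apply/ffunP => -[A | u]; last by have := eqst u; rewrite !ffunE.
  have [h ->] := orbit_ofP A.
  by have := congr1 (fun g : {ffun H -> H} => g h) (etrans Fs (esym Ft)); rewrite !ffunE.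
rewrite -(card_in_imset injR); apply: eq_card => t; rewrite [RHS]inE.
apply/imsetP/extendsP => [[s + ->] | [tt ft]].
  rewrite !inE => /andP[/is_homP homs /eqP <-].
  split=> [u u' | u v h lv] auv; rewrite !ffunE; first exact: homs.
  by apply: homs => /=; apply/existsP; exists v; rewrite lv eqxx.
have value (A : orbit_type p) : exists x, forall h, orbit_of p h = A -> f h = x.
  have [h ->] := orbit_ofP A; exists (f h) => h'; exact: fixed_orbit.
have [fA fAP] := fin_all_exists value.
pose s : {ffun pinned_graph p J -> H} :=
  [ffun x : pinned_graph p J => match x with inl A => fA A | inr u => t u end].
exists s; last by apply/ffunP=> u; rewrite !ffunE.
rewrite !inE; apply/andP; split; last first.
  by apply/eqP/ffunP=> h; rewrite !ffunE -(fAP _ h).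
apply/is_homP.
have nbr A (u : U) : orbit_nbr A (val u) -> adj (fA A) (t u).
  case/existsP=> v; case lv: (lab v) => [h|] // /andP[/eqP eA avu].
  by rewrite -(fAP _ h eA); apply: ft lv avu.
case=> [A|u] [B|v] /=; rewrite !ffunE; last exact: tt.
- by case/andP=> _ /existsP[a /existsP[b /and3P[/eqP/fAP<- /eqP/fAP<-]]]; apply: endof.
- exact: nbr.
by move/nbr; rewrite adj_sym.
Qed.

(** After exchanging the sums, each endomorphism [f] counts its extensions once per permutation
    fixing it, hence an even number of times unless [f] is injective. The injective ones are the
    automorphisms: an odd number, all with equally many extensions. *)
Lemma parity_pinned : involution_free H ->
  odd #|LabHom J| =
  labels_consistent && odd (\sum_(p : {perm H} | unmixed p) #|Hom (pinned_graph p J) H|).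
Proof.
move=> invfree; rewrite card_LabHom; case: labels_consistent => //=.
rewrite (eq_bigr _ card_Hom_pinned).
rewrite (exchange_big_dep (fun f => endo f)) /=; last by move=> p f _ /andP[].
rewrite (@odd_sum_congr _ _ _ (fun f => #|extensions f| * injectiveb f)); last first.
  move=> f endof; rewrite sum_nat_const oddM mulnC.
  (* A permutation fixing an endomorphism is automatically unmixed: an edge inside an orbit would be
     sent to a loop. *)
  have -> : #|[pred p | unmixed p & endo f && (p \in fixers f)]| = #|fixers f|.
    apply: eq_card => p; rewrite inE endof /=; case pf: (p \in _); rewrite ?andbF // andbT.
    apply/forallP=> a; apply/forallP=> b; apply/implyP=> /eqP /(fixed_orbit pf) eqf.
    by apply/negP => /(endoP _ endof); rewrite eqf adj_irr.
  by rewrite odd_card_fixers oddM oddb andbC.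
transitivity (odd (\sum_(f in [set f : {ffun H -> H} | endo f && injectiveb f])
                     #|extensions [ffun h => h]|)).
  by rewrite sum_nat_const oddM odd_card_automorphisms.
congr odd; under eq_bigl do rewrite inE.
rewrite big_mkcondr; apply: eq_bigr => f endof.
case: injectiveP => [injf|]; last by rewrite muln0.
by rewrite muln1 card_extensions_automorphism.
Qed.

End Pinning.

(** * Structured counter programs and oracle machines *)

(* A register is a tape with a single mark on its initial cell: its value is
   the position of the head.  The input head moves along with the register
   [pos], so that [pos] tells where it is. *)
Section CounterPrograms.

Variables (F R : finType) (pos : R).

Inductive op :=
  | Inc of R
  | Dec of R
  | Mem of (F -> symbol -> F)
  | Emit of (F -> bool).

Inductive test :=
  | Pos of R
  | One
  | Holds of (F -> bool).

Inductive cmd :=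
  | Do of op
  | Ask of (F -> bool -> F)
  | Seq of cmd & cmd
  | While of test & cmd
  | If of test & cmd & cmd.

Record conf := Conf { mem : F; reg : {ffun R -> nat}; word : seq bool }.

Definition setr (x : R) (v : nat) (r : {ffun R -> nat}) : {ffun R -> nat} :=
  [ffun y => if y == x then v else r y].

Lemma setr_neq x y v r : x != y -> setr x v r y = r y.
Proof. by rewrite ffunE eq_sym => /negbTE->. Qed.

Lemma setr_eq x v r : setr x v r x = v.
Proof. by rewrite ffunE eqxx. Qed.

Lemma setrC x y a b r : x != y -> setr x a (setr y b r) = setr y b (setr x a r).
Proof.
move=> nxy; apply/ffunP=> z; rewrite !ffunE.
by case: (eqVneq z x) => // ->; rewrite (negbTE nxy).
Qed.

Lemma setr_id x (r : {ffun R -> nat}) : setr x (r x) r = r.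
Proof. by apply/ffunP=> y; rewrite ffunE; case: eqP => // ->. Qed.

Lemma setr_setr x a b r : setr x a (setr x b r) = setr x a r.
Proof. by apply/ffunP=> y; rewrite !ffunE; case: eqP. Qed.

Definition set_reg (x : R) (v : nat) (s : conf) : conf :=
  Conf (mem s) (setr x v (reg s)) (word s).

Lemma set_reg_id x v s : reg s x = v -> set_reg x v s = s.
Proof. by move=> <-; rewrite /set_reg setr_id; case: s. Qed.

(** * Semantics and running time of counter programs *)

Section Semantics.

Variables (O : seq bool -> bool) (w : seq bool).

Definition input_at (p : nat) : symbol := nth None (map Some w) p.

Definition holds (t : test) (s : conf) : bool :=
  match t with
  | Pos x => 0 < reg s x
  | One => input_at (reg s pos) == Some true
  | Holds b => b (mem s)
  end.

Definition exec_op (o : op) (s : conf) : conf :=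
  match o with
  | Inc x => set_reg x (reg s x).+1 s
  | Dec x => set_reg x (reg s x).-1 s
  | Mem g => Conf (g (mem s) (input_at (reg s pos))) (reg s) (word s)
  | Emit b => Conf (mem s) (reg s) (b (mem s) :: word s)
  end.

(** The time counts instructions of the compiled code: a test is one branch, and the body of a loop
    or the first branch of a conditional is followed by one jump. [ExecWeak] turns the time into an
    upper bound. *)
Inductive exec : cmd -> conf -> conf -> nat -> Prop :=
  | ExecDo o s : exec (Do o) s (exec_op o s) 1
  | ExecAsk g s : exec (Ask g) s (Conf (g (mem s) (O (word s))) (reg s) [::]) 4
  | ExecSeq c1 c2 s1 s2 s3 t1 t2 :
      exec c1 s1 s2 t1 -> exec c2 s2 s3 t2 -> exec (Seq c1 c2) s1 s3 (t1 + t2)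
  | ExecStop b c s : ~~ holds b s -> exec (While b c) s s 1
  | ExecLoop b c s1 s2 s3 t1 t2 : holds b s1 ->
      exec c s1 s2 t1 -> exec (While b c) s2 s3 t2 ->
      exec (While b c) s1 s3 (t1 + t2 + 2)
  | ExecThen b c1 c2 s1 s2 t : holds b s1 ->
      exec c1 s1 s2 t -> exec (If b c1 c2) s1 s2 (t + 2)
  | ExecElse b c1 c2 s1 s2 t : ~~ holds b s1 ->
      exec c2 s1 s2 t -> exec (If b c1 c2) s1 s2 (t + 1)
  | ExecWeak c s1 s2 t t' : exec c s1 s2 t -> t <= t' -> exec c s1 s2 t'.

(** [Mem] and [One] read the input, so they depend on [pos]. *)
Fixpoint uses (x : R) (c : cmd) : bool :=
  let uses_test t := match t with Pos y => x == y | One => x == pos | Holds _ => false end in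
  match c with
  | Do (Inc y) | Do (Dec y) => x == y
  | Do (Mem _) => x == pos
  | Do (Emit _) | Ask _ => false
  | Seq c1 c2 => uses x c1 || uses x c2
  | While t c1 => uses_test t || uses x c1
  | If t c1 c2 => [|| uses_test t, uses x c1 | uses x c2]
  end.

(** This lets [repeat] alter its counters around a body that does not refer to them. *)
Lemma exec_frame x a c s s' t : ~~ uses x c ->
  exec c s s' t -> exec c (set_reg x a s) (set_reg x a s') t.
Proof.
move=> + ex; elim: ex => {c s s' t}.
- case=> [y|y|g|b] s /= nxy; try by apply: (ExecDo _ _).
  + have -> : set_reg x a (set_reg y (reg s y).+1 s) =
              exec_op (Inc y) (set_reg x a s).
      by rewrite /set_reg /= setrC ?setr_neq.
    exact: ExecDo.
  + have -> : set_reg x a (set_reg y (reg s y).-1 s) =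
              exec_op (Dec y) (set_reg x a s).
      by rewrite /set_reg /= setrC ?setr_neq.
    exact: ExecDo.
  have -> : set_reg x a (Conf (g (mem s) (input_at (reg s pos))) (reg s) (word s)) =
            exec_op (Mem g) (set_reg x a s).
    by rewrite /set_reg /= setr_neq.
  exact: ExecDo.
- by move=> g s _; apply: ExecAsk.
- move=> c1 c2 s1 s2 s3 t1 t2 _ IH1 _ IH2; rewrite /= negb_or => /andP[n1 n2].
  by apply: ExecSeq (IH1 n1) (IH2 n2).
- move=> b c s nb; rewrite /= negb_or => /andP[nt nc]; apply: ExecStop.
  by case: b nb nt => [y||b] //= + nt; rewrite setr_neq.
- move=> b c s1 s2 s3 t1 t2 hb _ IH1 _ IH2 /[dup] nbc; rewrite /= negb_or => /andP[nt nc].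
  apply: ExecLoop (IH1 nc) (IH2 nbc).
  by case: b hb nt {IH2 nbc} => [y||b] //= + nt; rewrite setr_neq.
- move=> b c1 c2 s1 s2 t hb _ IH; rewrite /= !negb_or => /and3P[nt nc _].
  apply: ExecThen (IH nc).
  by case: b hb nt => [y||b] //= + nt; rewrite setr_neq.
- move=> b c1 c2 s1 s2 t hb _ IH; rewrite /= !negb_or => /and3P[nt _ nc].
  apply: ExecElse (IH nc).
  by case: b hb nt => [y||b] //= + nt; rewrite setr_neq.
by move=> c s1 s2 t t' _ IH le nc; apply: ExecWeak (IH nc) le.
Qed.

Lemma exec_iter b c (g : nat -> conf) v T :
  (forall k, k < v -> holds b (g k) /\ exec c (g k) (g k.+1) T) ->
  ~~ holds b (g v) -> exec (While b c) (g 0) (g v) (v * (T + 2) + 1).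
Proof.
elim: v g => [|v IHv] g step stop; first exact: ExecStop.
have [b0 ex0] := step 0 isT.
have := IHv (fun k => g k.+1) (fun k lekv => step k.+1 lekv) stop.
move/(ExecLoop b0 ex0) => ex; apply: ExecWeak ex _.
by rewrite mulSn; lia.
Qed.

(* Runs [d] as many times as the value of [x], moving it to [u] and back again:
   [d] must use neither register. *)
Definition repeat (x u : R) (d : cmd) : cmd :=
  Seq (While (Pos x) (Seq (Do (Dec x)) (Do (Inc u))))
      (While (Pos u) (Seq (Do (Dec u)) (Seq (Do (Inc x)) d))).

Lemma exec_repeat x u d (g : nat -> conf) v T :
  x != u -> ~~ uses x d -> ~~ uses u d ->
  (forall k, k <= v -> reg (g k) x = v /\ reg (g k) u = 0) ->
  (forall k, k < v -> exec d (g k) (g k.+1) T) ->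
  exec (repeat x u d) (g 0) (g v) (v * (T + 8) + 2).
Proof.
move=> nxu nx nu vals step.
have nux : u != x by rewrite eq_sym.
(* [g] is the trajectory of [d] with [x] and [u] held at [v] and 0. The true configurations are [h]
   in the first loop and [h'] in the second, where the value [v] is split between the two
   registers. *)
pose h k := set_reg x (v - k) (set_reg u k (g 0)).
pose h' k := set_reg x k (set_reg u (v - k) (g k)).
have h0 : h 0 = g 0.
  by have [e1 e2] := vals 0 isT; rewrite /h subn0 (set_reg_id e2) set_reg_id.
have h'v : h' v = g v.
  by have [e1 e2] := vals v (leqnn v); rewrite /h' subnn (set_reg_id e2) set_reg_id.
have hh' : h v = h' 0 by rewrite /h /h' subnn subn0.
have ex1 : exec (While (Pos x) (Seq (Do (Dec x)) (Do (Inc u)))) (h 0) (h v) (v * (2 + 2) + 1).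
  apply: exec_iter => [k ltkv|]; last by rewrite /= setr_eq subnn.
  split; first by rewrite /= setr_eq subn_gt0.
  have -> : h k.+1 = exec_op (Inc u) (exec_op (Dec x) (h k)).
    rewrite /h subnS /= /set_reg /= !(setr_eq, setr_neq _ _ nxu, setr_neq _ _ nux) setr_setr.
    by rewrite [setr x _ (setr u k _)]setrC // setr_setr setrC.
  by apply: (ExecSeq (t1 := 1) (t2 := 1)); apply: ExecDo.
have ex2 : exec (While (Pos u) (Seq (Do (Dec u)) (Seq (Do (Inc x)) d))) (h' 0) (h' v)
                (v * (1 + (1 + T) + 2) + 1).
  apply: exec_iter => [k ltkv|]; last by rewrite /= setr_neq // setr_eq subnn.
  split; first by rewrite /= setr_neq // setr_eq subn_gt0.
  apply: ExecSeq (ExecDo _ _) _; apply: ExecSeq (ExecDo _ _) _.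
  have -> : exec_op (Inc x) (exec_op (Dec u) (h' k)) =
            set_reg x k.+1 (set_reg u (v - k.+1) (g k)).
    rewrite /h' subnS /= /set_reg /= !(setr_eq, setr_neq _ _ nxu, setr_neq _ _ nux).
    by rewrite [setr u _ (setr x _ _)]setrC // !setr_setr.
  by apply/exec_frame/exec_frame/step.
rewrite -h0 -h'v; apply: ExecWeak (ExecSeq ex1 _) _; first by rewrite hh'; apply: ex2.
by nia.
Qed.

End Semantics.

(** [IMark] puts the marks on the initial cells of the registers. [IBranch] falls through if its
    test holds and jumps otherwise, so that the test [Holds xpred0] gives an unconditional jump. *)
Inductive instr :=
  | IMark
  | IOp of op
  | IAsk of (F -> bool -> F)
  | IBranch of test & nat
  | IQueryMove of move.

(* The query tape is written leftwards and its head rests on the blank before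
   the word.  [Ask] steps onto the word and back, then once more to the left,
   so that a blank separates the old word from the next one. *)
Fixpoint compile (c : cmd) (o : nat) : seq instr :=
  match c with
  | Do a => [:: IOp a]
  | Ask g => [:: IQueryMove MoveRight; IAsk g; IQueryMove MoveLeft; IQueryMove MoveLeft]
  | Seq c1 c2 =>
      let k1 := compile c1 o in k1 ++ compile c2 (o + size k1)
  | While b c1 =>
      let k1 := compile c1 o.+1 in
      IBranch b (o + size k1).+2 :: k1 ++ [:: IBranch (Holds xpred0) o]
  | If b c1 c2 =>
      let k1 := compile c1 o.+1 in
      let k2 := compile c2 (o + size k1).+2 in
      IBranch b (o + size k1).+2 ::
        k1 ++ IBranch (Holds xpred0) ((o + size k1).+2 + size k2) :: k2
  end.

(** * The oracle machine executing compiled code *)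

Definition tapes_of : finType := (bool + R)%type.
Definition input_tape_of : tapes_of := inl true.
Definition query_tape_of : tapes_of := inl false.

Section Instructions.

Variables (i : instr) (m : F) (rd : {ffun tapes_of -> symbol}).

Definition test_read (t : test) : bool :=
  match t with
  | Pos x => rd (inr x) != Some true
  | One => rd input_tape_of == Some true
  | Holds b => b m
  end.

Definition next_pc (pc : nat) : nat :=
  if i is IBranch t o then if test_read t then pc.+1 else o else pc.+1.

Definition next_mem : F :=
  if i is IOp (Mem g) then g m (rd input_tape_of) else m.

(** A head on the mark does not move left, in agreement with [0.-1 = 0]. *)
Definition reg_move (r : R) : move :=
  match i with
  | IOp (Inc x) => if r == x then MoveRight else Stay
  | IOp (Dec x) => if (r == x) && (rd (inr r) != Some true) then MoveLeft else Stay
  | _ => Stay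
  end.

Definition action (t : tapes_of) : symbol * move :=
  match t with
  | inr r => (if i is IMark then Some true else rd t, reg_move r)
  | inl true => (rd t, reg_move pos)
  | inl false =>
      match i with
      | IOp (Emit b) => (Some (b m), MoveLeft)
      | IQueryMove d => (rd t, d)
      | _ => (rd t, Stay)
      end
  end.

End Instructions.

Section Simulation.

Variables (code : seq instr) (m0 : F) (out : F -> bool).

Definition state_of : finType := ('I_(size code).+1 * F)%type.

(** The program counter may equal [size code]; there no instruction is left and the machine
    halts. *)
Definition program_of (q : state_of) : command tapes_of state_of :=
  let: (pc, m) := q in
  match onth code pc with
  | None => Halt (out m)
  | Some (IAsk g) => Query (inord pc.+1, g m true) (inord pc.+1, g m false)
  | Some i => Step (fun rd => ((inord (next_pc i m rd pc), next_mem i m rd), action i m rd))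
  end.

Definition machine_of : oracle_machine :=
  OracleMachine input_tape_of query_tape_of (ord0, m0) program_of.

(** Cell [i] carries [f i] and the head is on cell [p]. Reading with default [None] ignores how many
    trailing blanks are stored; nothing is claimed about cells left of cell 0, so a move to the left
    needs [0 < p]. *)
Definition cursor (f : nat -> symbol) (p : nat) (t : tape) : Prop :=
  (forall i, nth None (rights t) i = f (p + i)) /\
  (forall i, i < p -> nth None (lefts t) i = f (p - i.+1)).

Lemma cursor_read f p t : cursor f p t -> read t = f p.
Proof. by case=> r _; rewrite /read -nth0 r addn0. Qed.

Definition shift (d : move) (p : nat) : nat :=
  match d with MoveLeft => p.-1 | Stay => p | MoveRight => p.+1 end.

Lemma cursor_move f p t d : cursor f p t -> (d = MoveLeft -> 0 < p) ->
  cursor f (shift d p) (write_move (read t) d t).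
Proof.
move=> c; have rt := cursor_read c; case: c => r l; case: d => [/(_ erefl)|_|_].
- case: p r l rt => // p r l rt _; rewrite /write_move /= rt; split=> [[|[|i]]|i ltip] /=.
  + by rewrite -nth0 l // subSS subn0 addn0.
  + by rewrite addn1.
  + by rewrite nth_behead r; congr f; lia.
  by rewrite nth_behead l //; congr f; lia.
- rewrite /write_move /= rt; split=> [[|i]|] //=; first by rewrite addn0.
  by rewrite nth_behead r.
rewrite /write_move /= rt; split=> [i|[|i] ltip] /=.
- by rewrite nth_behead r addnS.
- by rewrite subSS subn0.
by rewrite l //; congr f; lia.
Qed.

Lemma cursor_stay f p t : cursor f p t -> cursor f p (write_move (read t) Stay t).
Proof. by move=> c; apply: (cursor_move (d := Stay) c). Qed.

Definition marked (p : nat) : symbol := if p is 0 then Some true else None.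

(** Beyond the blank that ends the word, remains of earlier queries are allowed. *)
Definition queue (q : seq bool) (t : tape) : Prop :=
  [/\ read t = None, leading_word (behead (rights t)) = q
    & forall i, nth None (lefts t) i = None].

Variables (O : seq bool -> bool) (w : seq bool).

Definition represents (C : config machine_of) (pc : nat) (s : conf) : Prop :=
  [/\ C.1 = (inord pc, mem s),
      cursor (input_at w) (reg s pos) (C.2 input_tape_of),
      forall r, cursor marked (reg s r) (C.2 (inr r))
    & queue (word s) (C.2 query_tape_of)].

Local Notation step := (@step machine_of O).

Lemma onth_lt pc i : onth code pc = Some i -> pc < size code.
Proof. by move=> e; rewrite -onthTE e. Qed.

Lemma step_instr (C : config machine_of) pc m i :
  (if i is IAsk _ then False else True) ->
  onth code pc = Some i -> C.1 = (inord pc, m) ->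
  let rd := [ffun t => read (C.2 t)] in
  step C = ((inord (next_pc i m rd pc), next_mem i m rd),
            [ffun t => write_move (action i m rd t).1 (action i m rd t).2 (C.2 t)]).
Proof.
move=> ni ei eC rd; rewrite /step /= eC /= inordK; last exact: leqW (onth_lt ei).
by rewrite ei; case: i ni {ei}.
Qed.

Lemma read_marked C pc s r : represents C pc s ->
  (read (C.2 (inr r)) != Some true) = (0 < reg s r).
Proof. by case=> _ _ /(_ r) /cursor_read-> _; case: (reg s r). Qed.

Lemma step_op C pc s o : represents C pc s -> onth code pc = Some (IOp o) ->
  represents (step C) pc.+1 (exec_op w o s).
Proof.
move=> /[dup] rC [eC inC regC qC] eo; rewrite (step_instr _ eo eC) //.
set rd := finfun _.
have moves r : reg (exec_op w o s) r = shift (reg_move (IOp o) rd r) (reg s r) /\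
               (reg_move (IOp o) rd r = MoveLeft -> 0 < reg s r).
  case: o {eo} => [x|x|g|b] //=; rewrite ffunE.
    by case: eqP => [->|].
  rewrite ffunE (read_marked r rC); case: eqP => [->|] //=.
  by case: (reg s x).
split.
- congr (_, _) => /=; case: o {eo moves} => [x|x|g|b] //=.
  by rewrite ffunE (cursor_read inC).
- have [-> lt] := moves pos; rewrite ffunE.
  have -> : action (IOp o) (mem s) rd input_tape_of =
            (read (C.2 input_tape_of), reg_move (IOp o) rd pos) by rewrite /= ffunE.
  exact: cursor_move.
- move=> r; have [-> lt] := moves r; rewrite ffunE.
  have -> : action (IOp o) (mem s) rd (inr r) =
            (read (C.2 (inr r)), reg_move (IOp o) rd r) by rewrite /= ffunE.
  exact: cursor_move.
case: qC => rq wq lq; rewrite ffunE; case: o {eo moves} => [x|x|g|b] /=.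
1-3: by rewrite [rd _]ffunE rq /write_move; split.
split=> [||i]; rewrite /write_move /read /=.
- by rewrite -nth0 lq.
- by rewrite wq.
by rewrite nth_behead lq.
Qed.

Lemma step_branch C pc s b o : represents C pc s -> onth code pc = Some (IBranch b o) ->
  represents (step C) (if holds w b s then pc.+1 else o) s.
Proof.
move=> /[dup] rC [eC inC regC qC] eo; rewrite (step_instr _ eo eC) //.
set rd := finfun _.
split.
- congr (_, _) => /=; congr (inord (if _ then _ else _)); case: b {eo} => [x||b] //=.
    by rewrite ffunE (read_marked x rC).
  by rewrite ffunE (cursor_read inC).
- by rewrite ffunE /= [rd _]ffunE; apply: cursor_stay.
- by move=> r; rewrite ffunE /= [rd _]ffunE; apply: cursor_stay.
by case: qC => rq wq lq; rewrite ffunE /= [rd _]ffunE rq /write_move; split.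
Qed.

Lemma step_ask C pc s g : represents C pc s ->
  onth code pc = Some (IQueryMove MoveRight) ->
  onth code pc.+1 = Some (IAsk g) ->
  onth code pc.+2 = Some (IQueryMove MoveLeft) ->
  onth code pc.+3 = Some (IQueryMove MoveLeft) ->
  represents (iter 4 step C) (pc + 4) (Conf (g (mem s) (O (word s))) (reg s) [::]).
Proof.
case=> eC inC regC qC e0 e1 e2 e3; rewrite addn4.
rewrite /=.
have := step_instr (i := IQueryMove MoveRight) I e0 eC; case: (step C) => q1 T1 [eq1 eT1].
have eC1 : q1 = (inord pc.+1, mem s) by rewrite eq1.
(* The query itself is not covered by [step_instr] and is unfolded by hand. *)
have := erefl (step (q1, T1)); rewrite {2}/step /= eC1 /= inordK; last first.
  exact: leqW (onth_lt e1).
rewrite e1 => ->.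
set q2 := (if _ then _ else _).
have eC2 : q2 = (inord pc.+2, g (mem s) (O (word s))).
  rewrite /q2; have -> : word_of_tape (T1 query_tape_of) = word s.
    by case: qC => _ wq _; rewrite eT1 ffunE.
  by case: (O _).
have := step_instr (C := (q2, T1)) (i := IQueryMove MoveLeft) I e2 eC2.
case: (step (q2, T1)) => q3 T3 [eq3 eT3].
have eC3 : (q3, T3).1 = (inord pc.+3, g (mem s) (O (word s))) by rewrite /= eq3.
rewrite (step_instr (i := IQueryMove MoveLeft) I e3 eC3) /=; split=> //=.
- rewrite ffunE /= ffunE; apply: cursor_stay.
  rewrite eT3 ffunE /= ffunE; apply: cursor_stay.
  by rewrite eT1 ffunE /= ffunE; apply: cursor_stay.
- move=> r; rewrite ffunE /= ffunE; apply: cursor_stay.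
  rewrite eT3 ffunE /= ffunE; apply: cursor_stay.
  by rewrite eT1 ffunE /= ffunE; apply: cursor_stay.
case: qC => rq wq lq.
rewrite !(ffunE, eT3, eT1) /= !(ffunE, eT3, eT1) /= !ffunE /=.
rewrite /write_move /read /=; split=> [||i] /=.
- by rewrite -nth0 lq.
- by rewrite -/(read _) rq.
by rewrite nth_behead lq.
Qed.

Definition code_at (o : nat) (k : seq instr) : Prop :=
  exists k1 k2, code = k1 ++ k ++ k2 /\ size k1 = o.

Lemma code_at_cat o k1 k2 :
  code_at o (k1 ++ k2) -> code_at o k1 /\ code_at (o + size k1) k2.
Proof.
case=> [l1 [l2 [e <-]]]; split; first by exists l1, (k2 ++ l2); rewrite e -catA.
by exists (l1 ++ k1), l2; rewrite size_cat e !catA.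
Qed.

Lemma code_at_cons o i k : code_at o (i :: k) ->
  onth code o = Some i /\ code_at o.+1 k.
Proof.
rewrite -cat1s => /code_at_cat[[k1 [k2 [e <-]]]]; rewrite addn1; split=> //.
by rewrite e onth_cat ltnn subnn.
Qed.

(** Each instruction takes one machine step, so the count is exact in every case but [ExecWeak],
    which leaves only [t' <= t]. *)
Lemma exec_sim c o s s' t : exec O w c s s' t -> code_at o (compile c o) ->
  forall C, represents C o s ->
  exists2 t', t' <= t & represents (iter t' step C) (o + size (compile c o)) s'.
Proof.
move=> ex; elim: ex o => {c s s' t}.
- move=> a s o /code_at_cons[ea _] C rC; exists 1 => //=.
  by rewrite addn1; apply: step_op.
- move=> g s o /code_at_cons[e0] /code_at_cons[e1] /code_at_cons[e2] /code_at_cons[e3 _].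
  by move=> C rC; exists 4 => //; apply: step_ask.
- move=> c1 c2 s1 s2 s3 t1 t2 _ IH1 _ IH2 o /= /code_at_cat[at1 at2] C rC.
  have [t1' le1 rC1] := IH1 _ at1 _ rC.
  have [t2' le2 rC2] := IH2 _ at2 _ rC1.
  exists (t2' + t1'); first by rewrite addnC leq_add.
  by rewrite iterD size_cat addnA.
- move=> b c s nb o /= /code_at_cons[e0 _] C rC; exists 1 => //=.
  have := step_branch rC e0; rewrite (negbTE nb) size_cat /= addn1.
  by rewrite !addnS.
- move=> b c s1 s2 s3 t1 t2 hb _ IH1 _ IH2 o at0 C rC.
  have /= /code_at_cons[e0 /code_at_cat[at1 /code_at_cons[e1 _]]] := at0.
  have := step_branch rC e0; rewrite hb => rC0.
  have [t1' le1 rC1] := IH1 _ at1 _ rC0.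
  have rC2 := step_branch rC1 e1; rewrite /= in rC2.
  have [t2' le2 rC3] := IH2 _ at0 _ rC2.
  exists (t2' + (1 + (t1' + 1))); first by lia.
  by rewrite !iterD.
- move=> b c1 c2 s1 s2 t hb _ IH o /= /code_at_cons[e0 /code_at_cat[at1 /code_at_cons[e1 _]]].
  move=> C rC; have := step_branch rC e0; rewrite hb => rC0.
  have [t1' le1 rC1] := IH _ at1 _ rC0.
  have rC2 := step_branch rC1 e1; rewrite /= in rC2.
  exists (1 + (t1' + 1)); first by lia.
  rewrite !iterD; move: rC2; congr (represents _ _ _).
  by rewrite size_cat /=; lia.
- move=> b c1 c2 s1 s2 t hb _ IH o /= /code_at_cons[e0 /code_at_cat[_ /code_at_cons[_ at2]]].
  move=> C rC; have := step_branch rC e0; rewrite (negbTE hb) => rC0.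
  rewrite addSn in at2.
  have [t1' le1 rC1] := IH _ at2 _ rC0.
  exists (t1' + 1); first by lia.
  rewrite iterD; move: rC1; congr (represents _ _ _).
  by rewrite size_cat /=; lia.
move=> c s1 s2 t t' _ IH le o at0 C rC.
have [t1 le1 rC1] := IH _ at0 _ rC.
by exists t1 => //; apply: leq_trans le1 le.
Qed.

End Simulation.

Definition machine (c : cmd) (m0 : F) (out : F -> bool) : oracle_machine :=
  machine_of (IMark :: compile c 1) m0 out.

(** The strict inequality pays for the initial [IMark]. A halted configuration is its own successor,
    so the surplus steps change nothing. *)
Lemma machine_computes (c : cmd) m0 out O w s t T :
  exec O w c (Conf m0 [ffun=> 0] [::]) s t -> t < T ->
  computes_within (machine c m0 out) O w T (out (mem s)).
Proof.
set code := IMark :: compile c 1.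
pose M := machine_of code m0 out.
move=> ex ltT.
have at1 : code_at code 1 (compile c 1) by exists [:: IMark], [::]; rewrite cats0.
have rC : represents w (step O (init M w)) 1 (Conf m0 [ffun=> 0] [::]).
  have eC : (init M w).1 = (inord 0, m0).
    by congr (_, _); apply: val_inj; rewrite /= inordK.
  rewrite (step_instr (i := IMark) (pc := 0) _ _ _ eC) //; split=> /=.
  - by [].
  - rewrite !ffunE /= !ffunE /=; split=> //= i.
    by rewrite /read /input_at; case: i => [|i] /=; rewrite ?nth_behead -?nth0.
  - move=> r; rewrite !ffunE /=; split=> //= -[|i] //=.
    by rewrite nth_nil.
  by rewrite !ffunE /=; split=> [||i] /=; rewrite ?nth_nil // /read /= !ffunE.
have [t' le rC'] := exec_sim ex at1 rC.
rewrite /computes_within (_ : T = (T - t'.+1) + (t' + 1)); last by lia.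
rewrite !iterD; set C := iter t' _ _ in rC' *.
have fin : program C.1 = Halt (out (mem s)).
  case: rC' => -> _ _ _ /=; rewrite inordK // onth_default // add1n //.
elim: (T - _) => [|k IHk] /=; first by rewrite /output fin.
have -> : iter k (step O) C = C.
  by elim: k {IHk} => //= k ->; rewrite /step fin.
by rewrite /step fin /output fin.
Qed.

End CounterPrograms.

Arguments Inc {F R} _.
Arguments Dec {F R} _.
Arguments Mem {F R} _.
Arguments Emit {F R} _.
Arguments Pos {F R} _.
Arguments One {F R}.
Arguments Holds {F R} _.
Arguments Ask {F R} _.

(** * Loop programs over a partially labelled graph *)

Section LoopPrograms.

Variables (H : sgraph) (F V : finType).

(** Besides the head position and the loop indices there are two copies of the number of vertices
    and two scratch counters. Nested uses of [repeat] need distinct registers, hence the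
    duplicates. *)
Definition register : finType := (option (bool * bool) + V)%type.
Definition head_pos : register := inl None.
Definition size1 : register := inl (Some (false, false)).
Definition size2 : register := inl (Some (false, true)).
Definition aux1 : register := inl (Some (true, false)).
Definition aux2 : register := inl (Some (true, true)).
Definition index_reg (x : V) : register := inr x.

Local Notation cmd := (cmd F register).
Local Notation inc x := (Do (Inc x)).
Local Notation dec x := (Do (Dec x)).
Local Notation load g := (Do (Mem g)).

Definition home : cmd := While (Pos head_pos) (dec head_pos).

Definition advance (x : register) : cmd := repeat x aux1 (inc head_pos).

Definition advance_mul (x y : register) : cmd :=
  repeat x aux1 (repeat y aux2 (inc head_pos)).

(** In the encoding the entry sought is at position [n + 1 + x * n + y]: after the unary size, the
    separator, [x] full rows and [y] entries. *)
Definition load_adj (x y : V) (g : F -> bool -> F) : cmd :=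
  Seq (advance size1) (Seq (inc head_pos)
    (Seq (advance_mul (index_reg x) size2) (Seq (advance (index_reg y))
      (Seq (load (fun m a => g m (a == Some true))) home)))).

Definition skip_label : cmd :=
  Seq (While One (inc head_pos)) (inc head_pos).

Definition decode_label (k : nat) : option H :=
  if k is k'.+1 then onth (enum H) k' else None.

(** The loop is unrolled, so that the number [k] of ones seen so far is known from the place in the
    code; [#|H|] rounds suffice for every label. *)
Fixpoint read_label (fuel k : nat) (g : F -> option H -> F) : cmd :=
  let done := load (fun m _ => g m (decode_label k)) in
  if fuel is fuel'.+1 then
    If One (Seq (inc head_pos) (read_label fuel' k.+1 g)) done
  else done.

Definition load_label (x : V) (g : F -> option H -> F) : cmd :=
  Seq (advance size1) (Seq (inc head_pos)
    (Seq (advance_mul size1 size2)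
      (Seq (repeat (index_reg x) aux1 skip_label)
        (Seq (read_label #|H| 0 g) home)))).

(** Here [repeat] copies the size into the index register. As the index is decremented before the
    body, it runs from [n - 1] to 0 and the register ends at 0. *)
Definition for_loop (x : V) (body : cmd) : cmd :=
  Seq (repeat size1 aux1 (inc (index_reg x)))
      (While (Pos (index_reg x)) (Seq (dec (index_reg x)) body)).

Definition measure_input : cmd :=
  Seq (While One (Seq (inc head_pos) (Seq (inc size1) (inc size2)))) home.

Definition label_code (l : option H) : nat :=
  if l is Some h then (enum_rank h).+1 else 0.

Lemma encode_labelE (l : option H) :
  encode_label l = nseq (label_code l) true ++ [:: false].
Proof. by case: l. Qed.

Lemma label_codeK l : decode_label (label_code l) = l.
Proof.
case: l => [h|] //=; rewrite onthE (nth_map h) -?cardE ?ltn_ord //.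
by rewrite -enum_val_nth enum_rankK.
Qed.

Lemma label_code_le l : label_code l <= #|H|.
Proof. by case: l => [h|] //=; apply: ltn_ord. Qed.

(** The only loops range over the vertices, so [time] can be read off from the syntax and is
    polynomial. *)
Inductive prog :=
  | Skip
  | Update of (F -> F)
  | LoadAdj of V & V & (F -> bool -> F)
  | LoadLabel of V & (F -> option H -> F)
  | Output of (F -> bool)
  | Consult of (F -> bool -> F)
  | Then of prog & prog
  | When of (F -> bool) & prog
  | For of V & prog.

Fixpoint command_of (p : prog) : cmd :=
  match p with
  | Skip => load (fun m _ => m)
  | Update g => load (fun m _ => g m)
  | LoadAdj x y g => load_adj x y g
  | LoadLabel x g => load_label x g
  | Output b => Do (Emit b)
  | Consult g => Ask g
  | Then p1 p2 => Seq (command_of p1) (command_of p2)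
  | When b p1 => If (Holds b) (command_of p1) (load (fun m _ => m))
  | For x p1 => for_loop x (command_of p1)
  end.

Fixpoint scoped (S : seq V) (p : prog) : bool :=
  match p with
  | LoadAdj x y _ => (x \in S) && (y \in S)
  | LoadLabel x _ => x \in S
  | Then p1 p2 => scoped S p1 && scoped S p2
  | When _ p1 => scoped S p1
  | For x p1 => (x \notin S) && scoped (x :: S) p1
  | _ => true
  end.

(* Indices are visited in decreasing order, as they are counted down to 0. *)
Fixpoint countdown (T : Type) (f : nat -> T -> T) (k : nat) (s : T) : T :=
  if k is k'.+1 then countdown f k' (f k' s) else s.

Definition adj_time (l : nat) : nat :=
  (l * 9 + 2) + (1 + ((l * (l * 9 + 10) + 2) + ((l * 9 + 2) + (1 + (l * 3 + 1))))).

Definition label_time (l : nat) : nat :=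
  (l * 9 + 2) + (1 + ((l * (l * 9 + 10) + 2) + ((l * (l * 3 + 10) + 2) +
    ((#|H| * 4 + 4) + (l * 3 + 1))))).

Fixpoint time (p : prog) (l : nat) : nat :=
  match p with
  | Skip | Update _ | Output _ => 1
  | LoadAdj _ _ _ => adj_time l
  | LoadLabel _ _ => label_time l
  | Consult _ => 4
  | Then p1 p2 => time p1 l + time p2 l
  | When _ p1 => time p1 l + 2
  | For _ p1 => (l * 9 + 2) + (l * (time p1 l + 3) + 1)
  end.

(** * Execution of loop programs on an encoded instance *)

Section Input.

Variables (mat : seq bool) (labs : seq (option H)).
Hypothesis size_mat : size mat = size labs * size labs.

Local Notation n := (size labs).
Definition matrix_bit (i j : nat) : bool := nth false mat (i * n + j).
Definition label_at (i : nat) : option H := nth None labs i.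

Definition input_word : seq bool :=
  nseq n true ++ false :: mat ++ flatten (map (@encode_label H) labs).

Local Notation w := input_word.
Local Notation L := (size input_word).

(** The position in the input where the code of the label of vertex [k] begins. *)
Definition label_pos (k : nat) : nat :=
  n.+1 + n * n + size (flatten (map (@encode_label H) (take k labs))).

Lemma input_at_unary i : i < n -> input_at w i = Some true.
Proof.
move=> lt; rewrite /input_at (nth_map false) ?size_cat ?size_nseq; last by lia.
by rewrite nth_cat size_nseq lt nth_nseq lt.
Qed.

Lemma input_at_separator : input_at w n = Some false.
Proof.
rewrite /input_at (nth_map false) ?size_cat ?size_nseq /=; last by lia.
by rewrite nth_cat size_nseq ltnn subnn.
Qed.

Lemma input_at_matrix i j : i < n -> j < n ->
  input_at w (n.+1 + i * n + j) = Some (matrix_bit i j).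
Proof.
move=> lti ltj.
have lt : i * n + j < size mat by rewrite size_mat; nia.
rewrite /input_at (nth_map false); last first.
  by rewrite size_cat size_nseq /= size_cat; nia.
congr Some; rewrite nth_cat size_nseq ltnNge (_ : n <= _) /=; last by lia.
rewrite (_ : _ - n = (i * n + j).+1) /=; last by lia.
by rewrite nth_cat lt.
Qed.

Lemma size_input : L = label_pos n.
Proof. by rewrite size_cat size_nseq /= size_cat /label_pos take_size size_mat; lia. Qed.

Lemma label_posS k : k < n -> label_pos k.+1 = label_pos k + (label_code (label_at k)).+1.
Proof.
move=> lt; rewrite /label_pos (take_nth None) // map_rcons flatten_rcons size_cat.
by rewrite encode_labelE size_cat size_nseq /= addn1 addnA.
Qed.

Lemma label_pos_le k : k <= n -> label_pos k <= L.
Proof.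
move=> le; rewrite size_input /label_pos leq_add2l take_size -{2}(cat_take_drop k labs).
by rewrite map_cat flatten_cat size_cat leq_addr.
Qed.

Lemma input_at_label k i : k < n -> i <= label_code (label_at k) ->
  input_at w (label_pos k + i) = Some (i < label_code (label_at k)).
Proof.
move=> lt le.
have ltL : label_pos k + i < L.
  by apply: leq_trans (label_pos_le lt); rewrite label_posS // ltn_add2l ltnS.
rewrite /input_at (nth_map false) //; congr Some.
rewrite /label_pos nth_cat size_nseq ltnNge (_ : n <= _) /=; last by lia.
set fl := size (flatten _).
rewrite (_ : _ - n = (n * n + (fl + i)).+1) /=; last by lia.
rewrite nth_cat size_mat ltnNge leq_addr /= addKn.
rewrite -{1}(cat_take_drop k labs) map_cat flatten_cat nth_cat -/fl ltnNge leq_addr /= addKn.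
rewrite (drop_nth None lt) /= -/(label_at k) encode_labelE -catA nth_cat size_nseq nth_nseq.
by case: ltngtP le => // -> _; rewrite subnn.
Qed.

Lemma n_le_L : n <= L. Proof. by rewrite size_cat size_nseq leq_addr. Qed.

Variable O : seq bool -> bool.

Local Notation exec := (exec head_pos O w).

(** The invariant between operations: both size registers hold [n], and both scratch counters are
    0. *)
Definition loop_conf (p : nat) (e : {ffun V -> nat}) (s : F * seq bool) : conf F register :=
  Conf s.1 [ffun r : register => match r with
     | inl None => p
     | inl (Some (b, _)) => if b then 0 else n
     | inr x => e x
     end] s.2.

Lemma inc_head p e s : exec_op head_pos w (Inc head_pos) (loop_conf p e s) = loop_conf p.+1 e s.
Proof.
rewrite /= /set_reg /=; congr Conf; apply/ffunP=> -[[[[] c]|]|x]; rewrite !ffunE //=.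
Qed.

Lemma dec_head p e s : exec_op head_pos w (Dec head_pos) (loop_conf p e s) = loop_conf p.-1 e s.
Proof.
rewrite /= /set_reg /=; congr Conf; apply/ffunP=> -[[[[] c]|]|x]; rewrite !ffunE //=.
Qed.

Lemma exec_inc_head p e s : exec (inc head_pos) (loop_conf p e s) (loop_conf p.+1 e s) 1.
Proof. by rewrite -inc_head; apply: ExecDo. Qed.

Lemma exec_home p e s : p <= L -> exec home (loop_conf p e s) (loop_conf 0 e s) (L * 3 + 1).
Proof.
move=> le; have := @exec_iter _ _ head_pos O w (Pos head_pos) (dec head_pos)
  (fun k => loop_conf (p - k) e s) p 1.
rewrite subn0 subnn => ex; apply: ExecWeak (ex _ _) _ => [k lt||]; last by lia.
  split; first by rewrite /= ffunE subn_gt0.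
  by rewrite subnS -dec_head; apply: ExecDo.
by rewrite /= ffunE.
Qed.

Lemma exec_advance x p e s : x != head_pos -> x != aux1 ->
  reg (loop_conf p e s) x <= L ->
  exec (advance x) (loop_conf p e s) (loop_conf (p + reg (loop_conf p e s) x) e s) (L * 9 + 2).
Proof.
move=> nxp nxa; set v := reg _ x => le.
have val k : reg (loop_conf (p + k) e s) x = v.
  by rewrite /v !ffunE; case: (x) nxp => [[]|] //.
have := @exec_repeat _ _ head_pos O w x aux1 (inc head_pos) (fun k => loop_conf (p + k) e s) v 1.
rewrite addn0 => ex; apply: ExecWeak (ex _ _ _ _ _) _ => // [k _|k _|]; last by rewrite leq_add2r leq_mul.
  by rewrite val /= ffunE.
by rewrite addnS; apply: exec_inc_head.
Qed.

Lemma exec_advance_mul x y p e s : x != head_pos -> x != aux1 -> x != aux2 -> x != y ->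
  y != head_pos -> y != aux1 -> y != aux2 ->
  reg (loop_conf p e s) x <= L -> reg (loop_conf p e s) y <= L ->
  exec (advance_mul x y) (loop_conf p e s)
    (loop_conf (p + reg (loop_conf p e s) x * reg (loop_conf p e s) y) e s)
    (L * (L * 9 + 10) + 2).
Proof.
move=> nxp nx1 nx2 nxy nyp ny1 ny2; set v := reg _ x; set u := reg _ y => lev leu.
have val z k : z != head_pos -> reg (loop_conf k e s) z = reg (loop_conf p e s) z.
  by rewrite !ffunE; case: z => [[]|] //.
pose g k := loop_conf (p + k * u) e s.
have := @exec_repeat _ _ head_pos O w x aux1 (repeat y aux2 (inc head_pos)) g v (L * 9 + 2).
rewrite /g mul0n addn0 => ex; apply: ExecWeak (ex _ _ _ _ _) _ => //.
- by rewrite /= (negbTE nx2) (negbTE nxy) (negbTE nxp).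
- by rewrite /= eq_sym (negbTE ny1).
- by move=> k _; split; [exact: val | rewrite /= ffunE].
- move=> k _.
  pose g' j := loop_conf (p + k * u + j) e s.
  have := @exec_repeat _ _ head_pos O w y aux2 (inc head_pos) g' u 1.
  rewrite /g' addn0 => ex'; rewrite mulSn [u + _]addnC addnA.
  apply: ExecWeak (ex' _ _ _ _ _) _ => // [j _|j _|]; last by rewrite leq_add2r leq_mul.
    by split; [exact: val | rewrite /= ffunE].
  by rewrite addnS; apply: exec_inc_head.
by rewrite -addnA leq_add2r leq_mul.
Qed.

Lemma matrix_pos_le i j : i < n -> j < n -> n.+1 + i * n + j <= L.
Proof. by move=> lti ltj; rewrite size_input /label_pos; nia. Qed.

Lemma exec_load_adj x y g (e : {ffun V -> nat}) s : e x < n -> e y < n ->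
  exec (load_adj x y g) (loop_conf 0 e s)
    (loop_conf 0 e (g s.1 (matrix_bit (e x) (e y)), s.2)) (adj_time L).
Proof.
move=> ltx lty; have nL := n_le_L.
have e1 := @exec_advance size1 0 e s isT isT.
rewrite ffunE /= in e1; apply: ExecSeq (e1 nL) _.
apply: ExecSeq (exec_inc_head _ _ _) _.
have e2 := @exec_advance_mul (index_reg x) size2 n.+1 e s isT isT isT isT isT isT isT.
rewrite !ffunE /= in e2; rewrite add0n; apply: ExecSeq (e2 _ nL) _; first by lia.
have e3 := @exec_advance (index_reg y) (n.+1 + e x * n) e s isT isT.
rewrite !ffunE /= in e3; apply: ExecSeq (e3 _) _; first by lia.
have e4 := @ExecDo _ _ head_pos O w (Mem (fun m a => g m (a == Some true)))
  (loop_conf (n.+1 + e x * n + e y) e s).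
apply: ExecSeq e4 _.
set s' := exec_op _ _ _ _.
have -> : s' = loop_conf (n.+1 + e x * n + e y) e (g s.1 (matrix_bit (e x) (e y)), s.2).
  by rewrite /s' /= ffunE input_at_matrix //=; case: matrix_bit.
exact/exec_home/matrix_pos_le.
Qed.

Lemma exec_skip_label k e s : k < n ->
  exec skip_label (loop_conf (label_pos k) e s) (loop_conf (label_pos k.+1) e s) (L * 3 + 2).
Proof.
move=> lt; set c := label_code (label_at k).
have lec : c <= L.
  by apply: leq_trans (label_pos_le lt); rewrite label_posS // -/c; lia.
have := @exec_iter _ _ head_pos O w One (inc head_pos)
  (fun i => loop_conf (label_pos k + i) e s) c 1.
rewrite addn0 => ex; apply: ExecWeak (ExecSeq (ex _ _) _) _ => //.
- move=> i lti; split; last by rewrite addnS; apply: exec_inc_head.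
  by rewrite /= ffunE input_at_label // ?lti // ltnW.
- by rewrite /= ffunE input_at_label // ltnn.
- by rewrite label_posS // addnS; apply: exec_inc_head.
by lia.
Qed.

Lemma exec_read_label fuel i k g e s :
  k < n -> i <= label_code (label_at k) <= i + fuel ->
  exec (read_label fuel i g) (loop_conf (label_pos k + i) e s)
    (loop_conf (label_pos k + label_code (label_at k)) e (g s.1 (label_at k), s.2))
    (fuel * 4 + 4).
Proof.
move=> lt; elim: fuel i => [|fuel IH] i /andP[le1 le2].
  have -> : i = label_code (label_at k) by lia.
  rewrite /= label_codeK; apply: (@ExecWeak _ _ _ _ _ _ _ _ 1) => //.
  exact: (ExecDo _ _ _ (Mem _)).
rewrite [read_label _ _ _]/=.
have [lti | lei] := ltnP i (label_code (label_at k)).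
  apply: (@ExecWeak _ _ _ _ _ _ _ _ (1 + (fuel * 4 + 4) + 2)); last by lia.
  apply: ExecThen; first by rewrite /= ffunE input_at_label // lti.
  apply: ExecSeq (exec_inc_head _ _ _) _; rewrite -addnS.
  by apply: IH; lia.
have ei : i = label_code (label_at k) by lia.
apply: (@ExecWeak _ _ _ _ _ _ _ _ (1 + 1)); last by lia.
apply: ExecElse; first by rewrite /= ffunE input_at_label // ei ltnn.
by rewrite ei label_codeK; apply: (ExecDo _ _ _ (Mem _)).
Qed.

Lemma exec_load_label x g (e : {ffun V -> nat}) s : e x < n ->
  exec (load_label x g) (loop_conf 0 e s)
    (loop_conf 0 e (g s.1 (label_at (e x)), s.2)) (label_time L).
Proof.
move=> ltx; have nL := n_le_L.
have e1 := @exec_advance size1 0 e s isT isT.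
rewrite ffunE /= in e1; apply: ExecSeq (e1 nL) _.
apply: ExecSeq (exec_inc_head _ _ _) _.
have e2 := @exec_advance_mul size1 size2 n.+1 e s isT isT isT isT isT isT isT.
rewrite !ffunE /= in e2; rewrite add0n; apply: ExecSeq (e2 nL nL) _.
have e3 := @exec_repeat _ _ head_pos O w (index_reg x) aux1 skip_label
  (fun k => loop_conf (label_pos k) e s) (e x) (L * 3 + 2) isT isT isT.
have e0 : label_pos 0 = n.+1 + n * n by rewrite /label_pos take0 addn0.
rewrite e0 in e3; apply: ExecSeq (ExecWeak (e3 _ _) _) _.
- by move=> k _; rewrite !ffunE.
- by move=> k ltk; apply: exec_skip_label; apply: ltn_trans ltx.
- by nia.
have e4 := @exec_read_label #|H| 0 (e x) g e s ltx.
rewrite addn0 add0n in e4; apply: ExecSeq (e4 (label_code_le _)) _.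
apply: exec_home; apply: leq_trans (label_pos_le ltx); rewrite label_posS //; lia.
Qed.

Lemma exec_measure_input s :
  exec measure_input (Conf s.1 [ffun=> 0] s.2) (loop_conf 0 [ffun=> 0] s)
    ((L * 5 + 1) + (L * 3 + 1)).
Proof.
pose g k := Conf s.1 [ffun r : register => match r with
  | inl None => k | inl (Some (b, _)) => if b then 0 else k | inr x => 0 end] s.2.
have g0 : g 0 = Conf s.1 [ffun=> 0] s.2.
  by congr Conf; apply/ffunP=> -[[[[] c]|]|x]; rewrite !ffunE.
have gn : g n = loop_conf n [ffun=> 0] s.
  by congr Conf; apply/ffunP=> -[[[[] c]|]|x]; rewrite !ffunE.
have := @exec_iter _ _ head_pos O w One (Seq (inc head_pos) (Seq (inc size1) (inc size2))) g n 3.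
rewrite g0 gn => ex; apply: ExecSeq (ExecWeak (ex _ _) _) _.
- move=> k lt; split; first by rewrite /= ffunE input_at_unary.
  have -> : g k.+1 = exec_op head_pos w (Inc size2) (exec_op head_pos w (Inc size1)
                (exec_op head_pos w (Inc head_pos) (g k))).
    by congr Conf; apply/ffunP=> -[[[[] []]|]|x]; rewrite !ffunE.
  by apply: (ExecSeq (t1 := 1) (ExecDo _ _ _ _ _)); apply: (ExecSeq (t1 := 1) (t2 := 1)); apply: ExecDo.
- by rewrite /= ffunE input_at_separator.
- by have := n_le_L; nia.
exact/exec_home/n_le_L.
Qed.

Fixpoint run (p : prog) (e : {ffun V -> nat}) (s : F * seq bool) : F * seq bool :=
  match p with
  | Skip => s
  | Update g => (g s.1, s.2)
  | LoadAdj x y g => (g s.1 (matrix_bit (e x) (e y)), s.2)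
  | LoadLabel x g => (g s.1 (label_at (e x)), s.2)
  | Output b => (s.1, b s.1 :: s.2)
  | Consult g => (g s.1 (O s.2), [::])
  | Then p1 p2 => run p2 e (run p1 e s)
  | When b p1 => if b s.1 then run p1 e s else s
  | For x p1 => countdown (fun i => run p1 (setr x i e)) n s
  end.

Lemma loop_conf_set p x i (e : {ffun V -> nat}) s :
  set_reg (index_reg x) i (loop_conf p e s) = loop_conf p (setr x i e) s.
Proof.
by rewrite /set_reg; congr Conf; apply/ffunP=> -[[[b c]|]|y]; rewrite !ffunE.
Qed.

(** Indices out of scope are 0; hence [For] can load [n] into its fresh register by [n]
    increments. *)
Lemma exec_run p S (e : {ffun V -> nat}) s : scoped S p ->
  (forall x, if x \in S then e x < n else e x == 0) ->
  exec (command_of p) (loop_conf 0 e s) (loop_conf 0 e (run p e s)) (time p L).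
Proof.
elim: p S e s => [|g|x y g|x g|b|g|p1 IH1 p2 IH2|b p IH|x p IH] S e s //= sc eS.
- by case: s => m q; apply: (ExecDo _ _ _ (Mem _)).
- exact: (ExecDo _ _ _ (Mem _)).
- case/andP: sc => xS yS; have := eS x; have := eS y; rewrite xS yS => lty ltx.
  exact: exec_load_adj.
- by have := eS x; rewrite sc => ltx; apply: exec_load_label.
- exact: (ExecDo _ _ _ (Emit _)).
- exact: ExecAsk.
- case/andP: sc => sc1 sc2; apply: ExecSeq (IH1 _ _ _ sc1 eS) (IH2 _ _ _ sc2 eS).
- case hb: (b s.1); first by apply: ExecThen => //; apply: IH sc eS.
  apply: (@ExecWeak _ _ _ _ _ _ _ _ (1 + 1)); last by lia.
  apply: ExecElse; first by rewrite /= hb.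
  by case: s {hb} => m q; apply: (ExecDo _ _ _ (Mem _)).
case/andP: sc => xS sc.
have ex0 : e x = 0 by have := eS x; rewrite (negbTE xS) => /eqP.
have e0 : setr x 0 e = e by rewrite -ex0 setr_id.
have valx k s1 : reg (loop_conf 0 (setr x k e) s1) (index_reg x) = k.
  by rewrite ffunE /= setr_eq.
have incx k s1 : exec_op head_pos w (Inc (index_reg x)) (loop_conf 0 (setr x k e) s1) =
                 loop_conf 0 (setr x k.+1 e) s1.
  by rewrite /exec_op valx loop_conf_set setr_setr.
have decx k s1 : exec_op head_pos w (Dec (index_reg x)) (loop_conf 0 (setr x k e) s1) =
                 loop_conf 0 (setr x k.-1 e) s1.
  by rewrite /exec_op valx loop_conf_set setr_setr.
have nL := n_le_L.
apply: (@ExecSeq _ _ _ _ _ _ _ _ (loop_conf 0 (setr x n e) s)).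
  have := @exec_repeat _ _ head_pos O w size1 aux1 (inc (index_reg x))
    (fun k => loop_conf 0 (setr x k e) s) n 1 isT isT isT.
  rewrite e0 => ex; apply: ExecWeak (ex _ _) _ => [k _|k _|]; first by rewrite !ffunE.
    by rewrite -incx; apply: ExecDo.
  by rewrite leq_add2r leq_mul.
apply: (@ExecWeak _ _ _ _ _ _ _ _ (n * (time p L + 3) + 1)); last first.
  by rewrite leq_add2r leq_mul2r nL orbT.
(* When the register holds [k], the indices below [k] are still to be visited. *)
suff loop k : k <= n -> forall s,
    exec (While (Pos (index_reg x)) (Seq (dec (index_reg x)) (command_of p)))
      (loop_conf 0 (setr x k e) s)
      (loop_conf 0 e (countdown (fun i => run p (setr x i e)) k s))
      (k * (time p L + 3) + 1) by exact: loop.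
elim: k => [|k IHk] ltk {}s /=.
  by rewrite {1}e0; apply: ExecStop; rewrite /= ffunE /= ex0.
have lt : k <= n by apply: ltnW.
apply: ExecWeak (ExecLoop _ (ExecSeq (ExecDo _ _ _ _ _) _) (IHk lt _)) _.
- by rewrite /= valx.
- rewrite decx; apply: IH sc _ => y; rewrite inE.
  case: (eqVneq y x) => [-> | nyx] /=; first by rewrite setr_eq.
  by have nxy : x != y by [rewrite eq_sym]; rewrite (setr_neq _ _ nxy); apply: eS.
by rewrite mulSn; lia.
Qed.

(** The final [+ 1] is the step that marks the registers. *)
Definition whole_time (p : prog) (l : nat) : nat :=
  ((l * 5 + 1) + (l * 3 + 1)) + time p l + 1.

Lemma run_computes p m0 out : scoped [::] p ->
  computes_within (machine head_pos (Seq measure_input (command_of p)) m0 out) O w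
    (whole_time p L) (out (run p [ffun=> 0] (m0, [::])).1).
Proof.
move=> sc; have ex := exec_run (e := [ffun=> 0]) (m0, [::]) sc.
have := ExecSeq (exec_measure_input (m0, [::])) (ex _) => /(_ _)/machine_computes; apply.
  by move=> x; rewrite ffunE.
by rewrite /whole_time; lia.
Qed.

End Input.

(** * Polynomial bounds on running times *)

Definition polynomial (f : nat -> nat) : Prop :=
  exists p : {poly nat}, forall l, f l = p.[l]%R.

Lemma polynomial_const c : polynomial (fun=> c).
Proof. by exists (c%:P)%R => l; rewrite hornerC. Qed.

Lemma polynomial_id : polynomial id.
Proof. by exists 'X%R => l; rewrite hornerX. Qed.

Lemma polynomialD f g : polynomial f -> polynomial g -> polynomial (fun l => f l + g l).
Proof. by case=> p ep [q eq]; exists (p + q)%R => l; rewrite hornerD -ep -eq. Qed.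

Lemma polynomialM f g : polynomial f -> polynomial g -> polynomial (fun l => f l * g l).
Proof. by case=> p ep [q eq]; exists (p * q)%R => l; rewrite hornerM -ep -eq. Qed.

Ltac polynomial_tac :=
  repeat first [assumption | exact: polynomial_const | exact: polynomial_id
               | apply: polynomialD | apply: polynomialM].

Lemma polynomial_time p : polynomial (time p).
Proof. by elim: p => /= *; rewrite /adj_time /label_time; polynomial_tac. Qed.

Lemma polynomial_whole_time p : polynomial (whole_time p).
Proof. by have := polynomial_time p; rewrite /whole_time => ?; polynomial_tac. Qed.

End LoopPrograms.

Arguments Skip {H F V}.
Arguments Update {H F V} _.
Arguments LoadAdj {H F V} _ _ _.
Arguments Output {H F V} _.
Arguments Consult {H F V} _.

(** * The reduction *)

Section Reduction.

Variable H : sgraph.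

(** All data kept in the finite control: the parity of the answers so far, the consistency of the
    labels, two labels and a scratch bit. *)
Definition memory : finType :=
  ((bool * bool) * (option H * option H * bool))%type.

Definition parity (m : memory) := m.1.1.
Definition consistent (m : memory) := m.1.2.
Definition label1 (m : memory) := m.2.1.1.
Definition label2 (m : memory) := m.2.1.2.
Definition flag (m : memory) := m.2.2.

Definition add_parity (m : memory) (b : bool) : memory :=
  ((parity m (+) b, consistent m), m.2).
Definition require (b : memory -> bool) (m : memory) : memory :=
  ((parity m, consistent m && b m), m.2).
Definition set_label1 (m : memory) (l : option H) : memory :=
  (m.1, (l, label2 m, flag m)).
Definition set_label2 (m : memory) (l : option H) : memory :=
  (m.1, (label1 m, l, flag m)).
Definition set_flag (m : memory) (b : bool) : memory :=
  (m.1, (label1 m, label2 m, b)).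

Definition loop_index : finType := option bool.
Definition ix : loop_index := None.
Definition iy : loop_index := Some true.
Definition iz : loop_index := Some false.

Local Notation prog := (prog H memory loop_index).

Definition label_conflict_free (m : memory) : bool :=
  match label1 m, label2 m with
  | Some h, Some k => flag m ==> adj h k
  | _, _ => true
  end.

Definition check_labels : prog :=
  For ix (Then (LoadLabel ix set_label1)
    (For iy (Then (LoadLabel iy set_label2)
      (Then (LoadAdj ix iy set_flag) (Update (require label_conflict_free)))))).

(** [label1] is tested immediately after it is loaded, so a nested loop may overwrite it. *)
Definition for_unlabelled (x : loop_index) (q : prog) : prog :=
  For x (Then (LoadLabel x set_label1) (When (fun m => label1 m == None) q)).

(** The last element is treated first, which makes the output, written from right to left, appear in
    the order of the list. *)
Fixpoint backwards (T : Type) (s : seq T) (f : T -> prog) : prog :=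
  if s is a :: s' then Then (backwards s' f) (f a) else Skip.

Section Query.

Variable p : {perm H}.
Local Notation orbits := (enum (orbit_type p)).

Definition labelled_in (A : orbit_type p) (l : option H) : bool :=
  if l is Some h then orbit_of p h == A else false.

(** The flag accumulates the disjunction that defines [orbit_nbr], over all vertices [iz]. *)
Definition output_nbr (A : orbit_type p) (x : loop_index) : prog :=
  Then (Update (set_flag^~ false))
    (Then (For iz (Then (LoadLabel iz set_label2)
             (When (fun m => labelled_in A (label2 m))
               (LoadAdj iz x (fun m b => set_flag m (flag m || b))))))
       (Output flag)).

Definition output_adj (x y : loop_index) : prog :=
  Then (LoadAdj x y set_flag) (Output flag).

(* Words are output from right to left: the rows of the matrix come first,
   each one starting with its last entry, and the unary size comes last. *)
Definition output_graph : prog :=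
  Then (for_unlabelled ix (Then (for_unlabelled iy (output_adj ix iy))
                                (backwards orbits (fun A => output_nbr A ix))))
  (Then (backwards orbits (fun A =>
           Then (for_unlabelled iy (output_nbr A iy))
                (backwards orbits (fun B => Output (fun=> orbit_adj A B)))))
  (Then (Output (fun=> false))
  (Then (for_unlabelled ix (Output (fun=> true)))
        (backwards orbits (fun=> Output (fun=> true)))))).

End Query.

Fixpoint queries (s : seq {perm H}) : prog :=
  if s is p :: s' then Then (output_graph p) (Then (Consult add_parity) (queries s'))
  else Skip.

Definition reduction : prog :=
  Then check_labels (queries (enum [pred p | unmixed p])).

Lemma scoped_backwards (T : Type) (s : seq T) f S :
  (forall a, scoped S (f a)) -> scoped S (backwards s f).
Proof. by move=> sf; elim: s => //= a s ->; rewrite sf. Qed.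

Lemma scoped_reduction : scoped [::] reduction.
Proof.
rewrite /=; elim: (enum _) => //= p ps ->.
by rewrite !scoped_backwards // => A; rewrite /= scoped_backwards.
Qed.

Definition initial_memory : memory := ((false, true), (None, None, false)).

(** * The words written and the bits computed by the reduction *)

Section Run.

Variables (mat : seq bool) (labs : seq (option H)) (O : seq bool -> bool).
Local Notation n := (size labs).
Local Notation run := (run mat labs O).
Local Notation matrix_bit := (matrix_bit mat labs).
Local Notation label_at := (label_at labs).

Lemma iotaSr k : iota 0 k.+1 = iota 0 k ++ [:: k].
Proof. by rewrite -addn1 iotaD. Qed.

(** Labels and flag are scratch space, so only parity and consistency are required to survive. The
    word [W] must not depend on the starting state. *)
Definition outputs (q : prog) (e : {ffun loop_index -> nat}) (W : seq bool) : Prop :=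
  forall s, (run q e s).1.1 = s.1.1 /\ (run q e s).2 = W ++ s.2.

Lemma outputs_then q1 q2 e W1 W2 :
  outputs q1 e W1 -> outputs q2 e W2 -> outputs (Then q1 q2) e (W2 ++ W1).
Proof.
move=> o1 o2 s /=; have [k1 w1] := o1 s; have [k2 w2] := o2 (run q1 e s).
by rewrite k2 w2 k1 w1 catA.
Qed.

Lemma outputs_backwards (T : Type) (s : seq T) f e (W : T -> seq bool) :
  (forall a, outputs (f a) e (W a)) -> outputs (backwards s f) e (flatten (map W s)).
Proof. by move=> o; elim: s => [|a s IHs] //=; apply: outputs_then. Qed.

Lemma outputs_output e b : outputs (Output (fun=> b)) e [:: b].
Proof. by []. Qed.

Lemma outputs_for x q e W :
  (forall i, i < n -> outputs q (setr x i e) (W i)) ->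
  outputs (For x q) e (flatten (map W (iota 0 n))).
Proof.
move=> o; suff loop k : k <= n -> forall s,
    let s' := countdown (fun i => run q (setr x i e)) k s in
    s'.1.1 = s.1.1 /\ s'.2 = flatten (map W (iota 0 k)) ++ s.2 by move=> s; apply: loop.
elim: k => [|k IHk] ltk s //; rewrite iotaSr /=.
have [k1 w1] := o k ltk s; have [-> ->] := IHk (ltnW ltk) (run q (setr x k e) s).
by rewrite k1 w1 map_cat flatten_cat /= cats0 catA.
Qed.

Lemma outputs_for_unlabelled x q e W :
  (forall i, i < n -> label_at i = None -> outputs q (setr x i e) (W i)) ->
  outputs (for_unlabelled x q) e
    (flatten [seq W i | i <- [seq i <- iota 0 n | label_at i == None]]).
Proof.
move=> o; have -> : flatten [seq W i | i <- [seq i <- iota 0 n | label_at i == None]] =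
  flatten [seq if label_at i == None then W i else [::] | i <- iota 0 n].
  by elim: (iota 0 n) => //= i s IHs; case: ifP => //= _; rewrite IHs.
apply: outputs_for => i lti s /=; rewrite setr_eq /label1 /=.
by case: eqP => [/(o i lti)|] //; apply.
Qed.

Definition nbr_bit p (A : orbit_type p) (j : nat) : bool :=
  has (fun i => labelled_in A (label_at i) && matrix_bit i j) (iota 0 n).

Lemma outputs_nbr p (A : orbit_type p) x e : x != iz ->
  outputs (output_nbr A x) e [:: nbr_bit A (e x)].
Proof.
move=> nxz; have nzx : iz != x by rewrite eq_sym.
rewrite /nbr_bit => s /=; set f := fun i : nat => _; set c := fun i : nat => _.
suff loop k s1 : let s2 := countdown f k s1 in
    [/\ s2.1.1 = s1.1.1, s2.2 = s1.2 & flag s2.1 = flag s1.1 || has c (iota 0 k)].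
  by have [k1 w1 ->] := loop n (set_flag s.1 false, s.2); rewrite k1 w1.
elim: k s1 => [|k IHk] s1; first by rewrite /= orbF.
rewrite iotaSr /= has_cat.
have [-> -> ->] := IHk (f k s1).
have : [/\ (f k s1).1.1 = s1.1.1, (f k s1).2 = s1.2 & flag (f k s1).1 = flag s1.1 || c k].
  rewrite /f /c setr_eq (setr_neq _ _ nzx); case: (labelled_in A _) => /=; first by [].
  by rewrite orbF.
by case=> -> -> ->; rewrite /= orbF -orbA [c k || _]orbC.
Qed.

(** The encoding of the pinned graph, expressed through the raw input lists: orbits come first, then
    the unlabelled vertices in increasing order. *)
Definition outputs_graphE p : seq bool :=
  let U := [seq i <- iota 0 n | label_at i == None] in
  let orbits := enum (orbit_type p) in
  nseq (size orbits + size U) true ++ false ::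
  flatten [seq [seq orbit_adj A B | B <- orbits] ++ [seq nbr_bit A j | j <- U] | A <- orbits] ++
  flatten [seq [seq nbr_bit A i | A <- orbits] ++ [seq matrix_bit i j | j <- U] | i <- U].

Lemma flatten_seq1 (T T' : Type) (f : T -> T') s : flatten [seq [:: f x] | x <- s] = map f s.
Proof. by elim: s => //= a s ->. Qed.

Lemma outputs_graph p : outputs (output_graph p) [ffun=> 0] (outputs_graphE p).
Proof.
rewrite /outputs_graphE; set U := filter _ _;
set orbits := enum _.
(* The blocks are treated in the order of writing: rows of unlabelled vertices, rows of orbits, then
   the two portions of the unary size. *)
have o1 : outputs (for_unlabelled ix (Then (for_unlabelled iy (output_adj ix iy))
    (backwards orbits (fun A => output_nbr A ix)))) [ffun=> 0]
  (flatten [seq flatten [seq [:: nbr_bit A i] | A <- orbits] ++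
                flatten [seq [:: matrix_bit i j] | j <- U] | i <- U]).
  apply: outputs_for_unlabelled => i lti _; apply: outputs_then.
    apply: outputs_for_unlabelled => j ltj _ s /=.
    by rewrite setr_eq (@setr_neq _ iy ix) // setr_eq.
  apply: outputs_backwards => A; have := @outputs_nbr p A ix (setr ix i [ffun=> 0]) isT.
  by rewrite setr_eq.
have o2 : outputs (backwards orbits (fun A =>
           Then (for_unlabelled iy (output_nbr A iy))
                (backwards orbits (fun B => Output (fun=> orbit_adj A B))))) [ffun=> 0]
  (flatten [seq flatten [seq [:: orbit_adj A B] | B <- orbits] ++
                flatten [seq [:: nbr_bit A j] | j <- U] | A <- orbits]).
  apply: outputs_backwards => A; apply: outputs_then.
    apply: outputs_for_unlabelled => j ltj _.
    by have := @outputs_nbr p A iy (setr iy j [ffun=> 0]) isT; rewrite setr_eq.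
  by apply: outputs_backwards.
have o3 : outputs (for_unlabelled ix (Output (fun=> true))) [ffun=> 0]
   (flatten [seq [:: true] | i <- U]).
  by apply: outputs_for_unlabelled.
have o4 : outputs (backwards orbits (fun=> Output (fun=> true))) [ffun=> 0]
   (flatten [seq [:: true] | A <- orbits]).
  by apply: outputs_backwards.
have := outputs_then o1 (outputs_then o2 (outputs_then (@outputs_output [ffun=> 0] false)
          (outputs_then o3 o4))).
rewrite !flatten_seq1 nseqD.
have const (T : Type) (s : seq T) : [seq true | _ <- s] = nseq (size s) true.
  by elim: s => //= a s ->.
rewrite !const -!catA /=; congr (outputs _ _ (_ ++ _ ++ _ :: _ ++ _)).
  by congr flatten; apply: eq_map => A; rewrite !flatten_seq1.
by congr flatten; apply: eq_map => i; rewrite !flatten_seq1.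
Qed.

Definition pair_consistent (l : option H) (b : bool) (l' : option H) : bool :=
  match l, l' with Some h, Some k => b ==> adj h k | _, _ => true end.

Lemma run_check_labels e s :
  (run check_labels e s).1.1 =
    (parity s.1, consistent s.1 &&
       all (fun i => all (fun j => pair_consistent (label_at i) (matrix_bit i j) (label_at j))
                         (iota 0 n)) (iota 0 n)) /\
  (run check_labels e s).2 = s.2.
Proof.
rewrite /check_labels [run _ _ _]/=; set f := fun i : nat => _.
have step i s1 : (f i s1).1.1 = (parity s1.1, consistent s1.1 &&
     all (fun j => pair_consistent (label_at i) (matrix_bit i j) (label_at j)) (iota 0 n)) /\
     (f i s1).2 = s1.2.
  rewrite /f setr_eq; set g := fun j : nat => _.
  (* The inner loop never overwrites [label1], which therefore still holds the label of vertex
     [i]. *)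
  suff loop k s2 : label1 s2.1 = label_at i -> let s3 := countdown g k s2 in
      s3.1.1 = (parity s2.1, consistent s2.1 &&
        all (fun j => pair_consistent (label_at i) (matrix_bit i j) (label_at j)) (iota 0 k)) /\
      s3.2 = s2.2 by exact: loop.
  elim: k s2 => [|k IHk] s2 l1; first by rewrite /= andbT; case: s2 {l1} => -[[]].
  rewrite iotaSr /= all_cat.
  have [|-> ->] := IHk (g k s2); first by rewrite -l1.
  rewrite /g setr_eq (@setr_neq _ iy ix) // setr_eq /=; split=> //; congr (_, _).
  rewrite /consistent /require /= andbT -andbA; congr (_ && _); rewrite andbC; congr (_ && _).
  by rewrite /label_conflict_free /= -l1.
suff loop k s1 : let s2 := countdown f k s1 in
    s2.1.1 = (parity s1.1, consistent s1.1 &&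
       all (fun i => all (fun j => pair_consistent (label_at i) (matrix_bit i j) (label_at j))
                         (iota 0 n)) (iota 0 k)) /\ s2.2 = s1.2 by exact: loop.
elim: k s1 => [|k IHk] s1; first by rewrite /= andbT; case: s1 => -[[]].
rewrite iotaSr /= all_cat.
have [-> ->] := IHk (f k s1); have [e1 ->] := step k s1; split=> //.
rewrite /parity /consistent e1 /= andbT -andbA; congr (_, _ && _); exact: andbC.
Qed.

Lemma run_queries ps s : s.2 = [::] ->
  (run (queries ps) [ffun=> 0] s).1.1 =
  (foldl (fun a p => a (+) O (outputs_graphE p)) (parity s.1) ps, consistent s.1).
Proof.
elim: ps s => [|p ps IH] s es; first by case: s {es} => -[[]].
have [] := outputs_graph p s; set s1 := run (output_graph p) _ s => k1 w1.
rewrite -[run (queries _) _ _]/(run (queries ps) _ (add_parity s1.1 (O s1.2), [::])) IH //.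
have ks : parity s1.1 = parity s.1 := congr1 fst k1.
have cs : consistent s1.1 = consistent s.1 := congr1 snd k1.
by rewrite w1 es cats0 -ks -cs.
Qed.

End Run.

(** * Agreement with the encodings of graphs *)

Section Encoding.

Variable J : partlab H.
Local Notation G := (underlying J).

Definition adj_bits : seq bool := [seq adj x y | x <- enum G, y <- enum G].
Definition labels : seq (option H) := [seq lab x | x <- enum G].

Lemma size_labels : size labels = #|G|.
Proof. by rewrite size_map -cardE. Qed.

Lemma size_adj_bits : size adj_bits = size labels * size labels.
Proof. by rewrite size_labels size_allpairs -cardE. Qed.

Lemma input_word_labels : input_word adj_bits labels = encode_partlab J.
Proof.
by rewrite /input_word /encode_partlab /encode_graph size_labels -catA /= -map_comp.
Qed.

Definition rank (x : G) : nat := enum_rank x.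

Lemma rank_enum : [seq rank x | x <- enum G] = iota 0 (size labels).
Proof.
rewrite size_labels; apply: (@eq_from_nth _ 0) => [|i]; rewrite size_map -cardE ?size_iota // => ltG.
rewrite (nth_map (enum_val (Ordinal ltG))) -?cardE // nth_iota // -(enum_val_nth _ (Ordinal ltG)).
by rewrite /rank enum_valK.
Qed.

Lemma label_at_rank x : label_at labels (rank x) = lab x.
Proof.
rewrite /label_at (nth_map x) -?cardE ?ltn_ord //.
by rewrite -enum_val_nth enum_rankK.
Qed.

Lemma matrix_bit_rank x y : matrix_bit adj_bits labels (rank x) (rank y) = adj x y.
Proof.
rewrite /matrix_bit size_labels /adj_bits /rank.
have rk (z : G) : enum_rank z = index z (enum G) :> nat.
  rewrite -{2}[z]enum_rankK (enum_val_nth z) index_uniq ?enum_uniq //.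
  by rewrite -cardE.
have ly : index y (enum G) < #|G| by rewrite -rk.
rewrite !rk; suff gen (s : seq G) : x \in s ->
  nth false [seq adj u v | u <- s, v <- enum G] (index x s * #|G| + index y (enum G)) = adj x y.
  by apply: gen; rewrite mem_enum.
elim: s => //= u s IHs; rewrite in_cons nth_cat size_map -cardE.
case: (eqVneq u x) => [-> _ | neux].
  by rewrite mul0n add0n ly (nth_map x) ?nth_index ?mem_enum // -cardE.
by move=> /= /IHs <-; rewrite mulSn -addnA ltnNge leq_addr /= addKn.
Qed.

(** A subtype is enumerated in the order of the ambient type, so filtering the indices lists the
    unlabelled vertices in the order of their own enumeration. *)
Lemma unlabelled_indices :
  [seq i <- iota 0 (size labels) | label_at labels i == None] =
  [seq rank (val u) | u <- enum (unlabelled J)].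
Proof.
rewrite -rank_enum filter_map [RHS](map_comp rank val); congr (map rank _).
have -> : enum (unlabelled J) = pmap insub (enum G) by rewrite !enumT [in LHS]unlock.
rewrite pmap_filter; last exact: insubK.
by apply: eq_filter => x; rewrite /= label_at_rank isSome_insub.
Qed.

Lemma nbr_bitE p (A : orbit_type p) x :
  nbr_bit adj_bits labels A (rank x) = orbit_nbr A x.
Proof.
rewrite /nbr_bit -rank_enum has_map; apply/hasP/existsP => [[v _] | [v nbr]].
  rewrite /= label_at_rank matrix_bit_rank => h; exists v.
  by case: (lab v) h.
exists v; first by rewrite mem_enum.
by rewrite /= label_at_rank matrix_bit_rank; case: (lab v) nbr.
Qed.

Lemma enum_sum (A B : finType) :
  enum {: A + B} = map inl (enum A) ++ map inr (enum B).
Proof. by rewrite !enumT [in LHS]unlock. Qed.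

(** The oracle is reliable on encodings only, so the query must match one bit by bit; the
    enumeration of a sum type lists its left summand first, as the output does. *)
Lemma encode_pinned_graph p :
  outputs_graphE adj_bits labels p = encode_graph (pinned_graph p J).
Proof.
rewrite /outputs_graphE /encode_graph unlabelled_indices cardE enum_sum.
rewrite size_cat !size_map; congr (_ ++ _ :: _).
rewrite map_cat flatten_cat -!map_comp; congr (flatten _ ++ flatten _).
  apply: eq_map => A /=; rewrite map_cat -!map_comp; congr (_ ++ _).
  by apply: eq_map => u /=; rewrite nbr_bitE.
apply: eq_map => u /=; rewrite map_cat -!map_comp; congr (_ ++ _); apply: eq_map => v /=.
  by rewrite nbr_bitE.
by rewrite matrix_bit_rank.
Qed.

Lemma all_pair_consistent :
  all (fun i => all (fun j => pair_consistent (label_at labels i)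
         (matrix_bit adj_bits labels i j) (label_at labels j))
      (iota 0 (size labels))) (iota 0 (size labels)) = labels_consistent J.
Proof.
rewrite -rank_enum all_map; apply/allP/forallP => all1 x.
  have := all1 x (mem_enum _ _); rewrite /= all_map => /allP all2; apply/forallP=> y.
  have := all2 y (mem_enum _ _); rewrite /= !label_at_rank matrix_bit_rank.
  by case: (lab x) (lab y) => [h|] [k|].
move=> _; rewrite /= all_map; apply/allP=> y _.
have /forallP/(_ y) := all1 x; rewrite /= !label_at_rank matrix_bit_rank.
by case: (lab x) (lab y) => [h|] [k|].
Qed.

Lemma run_reduction O : solves (ParityHomsTo H) O ->
  let m := (run adj_bits labels O reduction [ffun=> 0] (initial_memory, [::])).1 in
  consistent m && parity m =
  labels_consistent J &&
    odd (\sum_(p : {perm H} | unmixed p) #|Hom (pinned_graph p J) H|).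
Proof.
move=> solvO /=.
have [] := run_check_labels adj_bits labels O [ffun=> 0] (initial_memory, [::]).
rewrite all_pair_consistent; set s := run _ _ _ check_labels _ _ => e1 e2.
have := run_queries adj_bits labels O (enum [pred p : {perm H} | unmixed p]) e2.
set m := (run _ _ _ (queries _) _ _).1 => em.
rewrite /consistent /parity em /consistent /parity e1 /=; congr (_ && _).
rewrite -(@big_enum _ _ _ _ [pred p | unmixed p]) /=.
(* Adding the answers modulo 2 gives the parity of the sum of the homomorphism counts. *)
have gen ps a : foldl (fun a p => a (+) O (outputs_graphE adj_bits labels p)) a ps =
          a (+) odd (\sum_(p <- ps) #|Hom (pinned_graph p J) H|).
  elim: ps a => [|p ps IH] a /=; first by rewrite big_nil addbF.
  by rewrite IH big_cons oddD encode_pinned_graph (solvO (pinned_graph p J)) addbA.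
exact: gen.
Qed.

End Encoding.

End Reduction.

Theorem theorem3p1 (H : sgraph) (hH : involution_free H) :
  poly_turing_reducible (ParityPartLabHomsTo H) (ParityHomsTo H).
Proof.
have [t et] := polynomial_whole_time (reduction H).
(* Machine and time bound depend on [H] alone. The output is 0 when the labels are inconsistent, and
   otherwise the accumulated parity. *)
exists (machine (head_pos loop_index) (Seq (measure_input (memory H) loop_index) (command_of (reduction H)))
         (initial_memory H) (fun m => consistent m && parity m)), t.
move=> O solvO J; rewrite /= -et -input_word_labels (parity_pinned J hH) -(run_reduction J solvO).
exact: (run_computes (size_adj_bits J) O (initial_memory H)
  (fun m => consistent m && parity m) (scoped_reduction H)).
Qed.
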